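(* Let $G$ and $G_1,\dots,G_N$ be finitely generated Abelian groups. For $1\le j\le N$ let $\varphi_j:G\to G_j$ be a homomorphism whose range is a subgroup of finite index in $G_j$, and let $p_j\in[1,\infty]$. Then there exists $C<\infty$ such that $$\sum_{y\in G}\prod_{j=1}^N f_j(\varphi_j(y))\le C\prod_{j=1}^N\|f_j\|_{\ell^{p_j}(G_j)}\quad\text{for all nonnegative functions } f_j \text{ on } G_j$$ if and only if $$\operatorname{rank}(H)\le\sum_{j=1}^N p_j^{-1}\operatorname{rank}(\varphi_j(H))\quad\text{for every subgroup } H \text{ of } G.$$
   Context: The $\ell^{p_j}(G_j)$ norms are defined with respect to counting measure on $G_j$. The convention $\infty^{-1}=0$ is used. The rank of a finitely generated Abelian group is the rank of its free part. *)

(* Defs.v *)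
From HB Require Import structures.
From mathcomp Require Import all_boot all_order all_algebra.
From mathcomp Require Import all_classical all_reals all_analysis.

Set Implicit Arguments.
Unset Strict Implicit.
Unset Printing Implicit Defensive.

Import Order.TTheory GRing.Theory Num.Theory.

Local Open Scope classical_set_scope.
Local Open Scope ring_scope.

(* Abelian groups are written additively, as (possibly infinite) zmodTypes. *)

Section AbelianGroups.
Variable A : zmodType.
Implicit Types (H S : set A).

Definition is_subgroup H : Prop := zmod_closed (mem H).

Definition finitely_generated : Prop :=
  exists2 S : set A, finite_set S & smallest is_subgroup S = [set: A].

Definition finite_index H : Prop :=
  finite_set (range (fun a : A => [set a + h | h in H])).

Definition torsion_part H : set A :=
  [set x | H x /\ exists2 n : nat, (0 < n)%N & x *+ n = 0].

Definition Zspan (r : nat) (b : 'I_r -> A) : set A :=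
  range (fun c : 'I_r -> int => \sum_(i < r) b i *~ c i).

Definition Zfree (r : nat) (b : 'I_r -> A) : Prop :=
  forall c : 'I_r -> int, \sum_(i < r) b i *~ c i = 0 -> forall i, c i = 0.

(* H is the internal direct sum of a free group with basis b and of the torsion
   part of H; freeness of b already makes the intersection trivial. *)
Definition free_part_basis H (r : nat) (b : 'I_r -> A) : Prop :=
  Zfree b /\ H = [set x + t | x in Zspan b & t in torsion_part H].

(* The value 0 is a default, reached only when H has no decomposition as above;
   every finitely generated H has one, and r is determined by H. *)
Definition rank H : nat :=
  xget 0%N [set r | exists b : 'I_r -> A, free_part_basis H b].

End AbelianGroups.

Arguments finitely_generated : clear implicits.

(* Copy of the carrier of A on which every subset is measurable. *)
Definition discrete_zmod (A : zmodType) : Type := A.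

Section DiscreteZmod.
Variable A : zmodType.

HB.instance Definition _ := Choice.on (discrete_zmod A).
HB.instance Definition _ := isPointed.Build (discrete_zmod A) (0 : A).
HB.instance Definition _ := @isMeasurable.Build default_measure_display
  (discrete_zmod A) discrete_measurable discrete_measurable0
  discrete_measurableC discrete_measurableU.

End DiscreteZmod.

Definition ell_norm (R : realType) (A : zmodType) (p : \bar R) (f : A -> R) :
    \bar R :=
  Lnorm (counting : {measure set (discrete_zmod A) -> \bar R}) p (EFin \o f).

(* Main.v *)
(* Necessity: test the inequality on indicators of the images under phi_j of a
   box of side M in the free part of H; as M grows, the two sides behave like
   M^rank(H) and M^(sum_j rank(phi_j(H)) / p_j).

   Sufficiency: tensoring with Q, at the cost of the finite torsion of G, reduces
   to Q-linear maps Phi_j and to the inequality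
     sum_y prod_j f_j(y Phi_j)^(s_j) <= prod_j (sum f_j)^(s_j),  s_j = 1/p_j,
   assuming rank W <= sum_j s_j rank(W Phi_j) for all subspaces W.  If equality
   holds for some W other than 0 and the whole space, the hypothesis passes to W
   and to the quotient, and one argues by induction on the dimension.  Otherwise,
   if two exponents are strictly between 0 and 1, move them in opposite
   directions, keeping the constraint of the whole space unchanged, until either
   some other W becomes critical or one of them reaches 0 or 1: s is a convex
   combination of the two end points, for which the inequality is known by
   induction, and the weighted arithmetic-geometric mean inequality interpolates
   between them.  If at most one exponent is fractional,
   the maps with exponent 1 are jointly injective. *)

Require Import Defs.
From HB Require Import structures.
From mathcomp Require Import all_boot all_order all_algebra finmap.
From mathcomp Require Import all_classical all_reals all_analysis.
From mathcomp Require Import ring lra zify ess_sup_inf.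

Set Implicit Arguments.
Unset Strict Implicit.
Unset Printing Implicit Defensive.

Import Order.TTheory GRing.Theory Num.Theory.

Local Open Scope classical_set_scope.
Local Open Scope ring_scope.

(** * Finite sums over lists, and real powers *)

Section FiniteSums.
Variable R : realType.

(** For nonnegative [f] this says that the total sum is at most [S], with no need for summability or
    extended reals. *)
Definition sum_le (T : eqType) (f : T -> R) (S : R) :=
  forall D : seq T, uniq D -> \sum_(z <- D) f z <= S.

Lemma ler_sum_sub (T : eqType) (f : T -> R) (D1 D2 : seq T) :
  (forall z, 0 <= f z) -> uniq D1 -> {subset D1 <= D2} ->
  \sum_(z <- D1) f z <= \sum_(z <- D2) f z.
Proof.
move=> f0; elim: D1 D2 => [|x D1 IH] D2 /=; first by rewrite big_nil sumr_ge0.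
case/andP=> xD1 uD1 sD; have xD2 : x \in D2 by apply: sD; rewrite mem_head.
rewrite big_cons (big_rem x xD2) /= lerD2l IH// => z zD1.
have := sD z; rewrite in_cons zD1 orbT => /(_ isT) zD2.
have zx : z != x by apply: contraNneq xD1 => <-.
by have := perm_mem (perm_to_rem xD2) z; rewrite zD2 in_cons (negPf zx).
Qed.

Lemma sum_pred1_seq (T : eqType) (D : seq T) (x : T) (F : T -> R) : uniq D ->
  \sum_(z <- D | x == z) F z = if x \in D then F x else 0.
Proof.
move=> uD; case: ifPn => xD; last first.
  by rewrite big_seq_cond big1// => z /andP[zD /eqP xz]; rewrite xz zD in xD.
rewrite big_mkcond (bigD1_seq x)//= eqxx big1 ?addr0// => z.
by rewrite eq_sym => /negPf ->.
Qed.

Lemma partition_big_seq (T U : eqType) (q : T -> U) (E : seq T) (f : T -> R) :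
  \sum_(y <- E) f y =
  \sum_(u <- undup (map q E)) \sum_(y <- E | q y == u) f y.
Proof.
rewrite (exchange_big_dep predT)//= !big_seq; apply: eq_bigr => y yE.
by rewrite (sum_pred1_seq _ (fun=> f y)) ?undup_uniq// mem_undup map_f.
Qed.

Lemma sum_le_ge0 (T : eqType) (f : T -> R) S : sum_le f S -> 0 <= S.
Proof. by move=> /(_ [::] isT); rewrite big_nil. Qed.

Lemma sum_le_at (T : eqType) (f : T -> R) S z : sum_le f S -> f z <= S.
Proof. by move=> /(_ [:: z] isT); rewrite big_seq1. Qed.

(** After exchanging the sums, each [z] of [D] is counted for at most one [u]. Restricting the
    fibres to a list [D] keeps the fibre sums finite. *)
Lemma sum_le_pushforward (T U : eqType) (q : T -> U) (D : seq T) (f : T -> R) S :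
  (forall z, 0 <= f z) -> uniq D -> sum_le f S ->
  sum_le (fun u => \sum_(z <- D | q z == u) f z) S.
Proof.
move=> f0 uD fS L uL; rewrite (exchange_big_dep predT)//=.
apply: le_trans (fS _ uD); apply: ler_sum => z _.
by rewrite (sum_pred1_seq _ (fun=> f z))//; case: ifP.
Qed.

(** Group the points by the value of the first map; on each fibre the remaining maps are still
    jointly injective. Once no map is left, joint injectivity leaves at most one point. *)
Lemma sum_le_prod (I T : eqType) (U : I -> eqType) (g : forall i, T -> U i)
    (f : forall i, U i -> R) (S : I -> R) (r : seq I) (E : seq T) :
  (forall i z, 0 <= f i z) -> (forall i, sum_le (f i) (S i)) -> uniq E ->
  {in E &, forall x y, (forall i, i \in r -> g i x = g i y) -> x = y} ->
  \sum_(y <- E) \prod_(i <- r) f i (g i y) <= \prod_(i <- r) S i.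
Proof.
move=> f0 fS; have S0 i : 0 <= S i by exact: sum_le_ge0 (fS i).
elim: r E => [|i r IH] E uE injE.
  case: E uE injE => [|x [|y E]] uE injE; first by rewrite !big_nil ler01.
    by rewrite big_seq1 !big_nil.
  have := injE x y; rewrite !inE !eqxx orbT => /(_ isT isT) xy.
  by move: uE; rewrite xy//= mem_head.
rewrite (partition_big_seq (g i)) big_cons.
apply: (@le_trans _ _ (\sum_(u <- undup (map (g i) E))
   (f i u * \prod_(k <- r) S k))).
  apply: ler_sum => u _.
  rewrite (eq_bigr (fun y => f i u * \prod_(k <- r) f k (g k y))); last first.
    by move=> y /eqP <-; rewrite big_cons.
  rewrite -mulr_sumr ler_wpM2l// -[X in X <= _]big_filter.
  apply: IH; first exact: filter_uniq.
  move=> x y; rewrite !mem_filter => /andP[/eqP xu xE] /andP[/eqP yu yE] xy.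
  apply: injE => // k; rewrite in_cons => /predU1P[->|/xy//].
  by rewrite xu yu.
by rewrite -mulr_suml ler_wpM2r ?prodr_ge0// fS// undup_uniq.
Qed.

Lemma powRD_ge0 (x a b : R) : 0 <= a -> 0 <= b ->
  x `^ (a + b) = x `^ a * x `^ b.
Proof.
move=> a0 b0; have [ab|ab] := eqVneq (a + b) 0; last by rewrite powRD// (negPf ab).
have -> : a = 0 by lra.
have -> : b = 0 by lra.
by rewrite addr0 powRr0 mulr1.
Qed.

Lemma powR_le1 (x a : R) : 0 <= x -> x <= 1 -> 0 <= a -> x `^ a <= 1.
Proof. by move=> x0 x1 a0; have := ge0_ler_powR a0 x0 ler01 x1; rewrite powR1. Qed.

(** Young's inequality for the conjugate exponents 1/(1-t) and 1/t; the end points, where one of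
    these is infinite, are treated by hand. *)
Lemma young_mean (x y t : R) : 0 <= x -> 0 <= y -> 0 <= t <= 1 ->
  x `^ (1 - t) * y `^ t <= (1 - t) * x + t * y.
Proof.
move=> x0 y0 /andP[t0 t1].
have [->|tn0] := eqVneq t 0; first by rewrite subr0 powRr1// powRr0; lra.
have [->|tn1] := eqVneq t 1; first by rewrite subrr powRr1// powRr0; lra.
have tp : 0 < t by rewrite lt0r tn0.
have t'p : 0 < 1 - t by rewrite subr_gt0 lt_neqAle tn1.
have := @conjugate_powR _ (x `^ (1 - t)) (y `^ t) (1 - t)^-1 t^-1
  (powR_ge0 _ _) (powR_ge0 _ _).
rewrite !invr_gt0 !invrK => /(_ t'p tp); rewrite subrK => /(_ erefl).
rewrite -!powRrM !divff ?gt_eqF// !powRr1//.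
by rewrite [x * _]mulrC [y * _]mulrC.
Qed.

Lemma powR_prod (I : Type) (r : seq I) (P : pred I) (f : I -> R) (a : R) :
  (forall i, 0 <= f i) ->
  (\prod_(i <- r | P i) f i) `^ a = \prod_(i <- r | P i) f i `^ a.
Proof.
move=> f0; suff : 0 <= \prod_(i <- r | P i) f i /\
  (\prod_(i <- r | P i) f i) `^ a = \prod_(i <- r | P i) f i `^ a by case.
elim/big_ind2 : _ => [|x1 x2 y1 y2 [? <-] [? <-]|i _//].
  by rewrite powR1.
by rewrite powRM ?mulr_ge0.
Qed.

End FiniteSums.

(** * The inequality for linear maps *)

Section BrascampLieb.
Variables (R : realType) (F : fieldType) (N : nat).

Section Fixed.
Variables (n : nat) (m : 'I_N -> nat) (Phi : forall j, 'M[F]_(n, m j)).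

(** Every subspace of F^n is the row space of a square matrix, so square [W] suffice. *)
Definition bl_cond (s : 'I_N -> R) := forall W : 'M[F]_n,
  (\rank W)%:R <= \sum_j s j * (\rank (W *m Phi j))%:R.

(** For finite p_j, [f j] plays the role of the p_j-th power of the original function; an infinite
    p_j becomes the exponent 0. The constant is 1. *)
Definition bl_ineq (s : 'I_N -> R) :=
  forall (f : forall j, 'rV[F]_(m j) -> R) (S : 'I_N -> R),
    (forall j z, 0 <= f j z) -> (forall j, sum_le (f j) (S j)) ->
  sum_le (fun y => \prod_j f j (y *m Phi j) `^ s j) (\prod_j S j `^ s j).

Lemma bl_cond_mx k (W : 'M[F]_(k, n)) s : bl_cond s ->
  (\rank W)%:R <= \sum_j s j * (\rank (W *m Phi j))%:R.
Proof.
move=> /(_ <<W>>%MS); rewrite mxrank_gen => /le_trans; apply.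
by apply: ler_sum => j _; rewrite (eqmxMr _ (genmxE W)).
Qed.

(** By homogeneity, divide each [f j] by [S j]. If [S j] is 0 then [f j] vanishes, and the default
    value 0 of the quotient is still correct. *)
Lemma bl_normalized s :
  (forall f : (forall j, 'rV[F]_(m j) -> R),
    (forall j z, 0 <= f j z) -> (forall j, sum_le (f j) 1) ->
    sum_le (fun y => \prod_j f j (y *m Phi j) `^ s j) 1) -> bl_ineq s.
Proof.
move=> H f S f0 fS E uE; have S0 j : 0 <= S j by exact: sum_le_ge0 (fS j).
have g0 j z : 0 <= f j z / S j by rewrite mulr_ge0 ?invr_ge0.
have fE j z : f j z = f j z / S j * S j.
  have [Sj0|Sj0] := eqVneq (S j) 0; last by rewrite divfK.
  apply/eqP; rewrite Sj0 mulr0 eq_le f0 andbT -Sj0; exact: sum_le_at (fS j).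
rewrite (eq_bigr (fun y => \prod_j S j `^ s j *
    \prod_j (f j (y *m Phi j) / S j) `^ s j)); last first.
  move=> y _; rewrite -big_split /=; apply: eq_bigr => j _.
  by rewrite {1}fE powRM// mulrC.
rewrite -mulr_sumr -[leRHS]mulr1 ler_wpM2l ?prodr_ge0//.
  by move=> j _; exact: powR_ge0.
apply: (H (fun j z => f j z / S j)) => // j D uD.
rewrite -mulr_suml; have [->|Sj0] := eqVneq (S j) 0.
  by rewrite invr0 mulr0.
by rewrite ler_pdivrMr ?mul1r; [exact: fS | rewrite lt0r Sj0 S0].
Qed.

(** Normalized functions are bounded by 1, so their powers decrease as the exponent grows. *)
Lemma bl_mono (s s' : 'I_N -> R) : (forall j, 0 <= s' j <= s j) -> bl_ineq s' -> bl_ineq s.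
Proof.
move=> ss' H; apply: bl_normalized => f f0 fS E uE.
have := H f (fun=> 1) f0 fS E uE; rewrite [leRHS]big1; last first.
  by move=> j _; rewrite powR1.
apply: le_trans; apply: ler_sum => y _; apply: ler_prod => j _.
have /andP[s0 sl] := ss' j; rewrite powR_ge0 /=.
rewrite -(subrK (s' j) (s j)) powRD_ge0 ?subr_ge0//.
rewrite ler_piMl ?powR_ge0// powR_le1 ?subr_ge0//; exact: sum_le_at (fS j).
Qed.

(** After normalization both bounds are 1, so the pointwise mean inequality sums to (1-t) + t =
    1. *)
Lemma bl_interp (a b : 'I_N -> R) t : (forall j, 0 <= a j) -> (forall j, 0 <= b j) ->
  0 <= t <= 1 -> bl_ineq a -> bl_ineq b ->
  bl_ineq (fun j => (1 - t) * a j + t * b j).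
Proof.
move=> a0 b0 /andP[t0 t1] Ha Hb; apply: bl_normalized => f f0 fS E uE.
have one c : \prod_(j < N) (1 : R) `^ c j = 1 by rewrite big1// => j _; rewrite powR1.
have := Ha f (fun=> 1) f0 fS E uE; have := Hb f (fun=> 1) f0 fS E uE.
rewrite !one => hb ha.
apply: (@le_trans _ _ (\sum_(y <- E)
   ((1 - t) * \prod_j f j (y *m Phi j) `^ a j
    + t * \prod_j f j (y *m Phi j) `^ b j))).
  apply: ler_sum => y _; apply: le_trans (young_mean _ _ _); last 3 first.
  - by apply: prodr_ge0 => j _; exact: powR_ge0.
  - by apply: prodr_ge0 => j _; exact: powR_ge0.
  - by rewrite t0.
  rewrite !powR_prod; try by move=> j; exact: powR_ge0.
  rewrite -big_split le_eqVlt; apply/orP; left; apply/eqP.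
  apply: eq_bigr => j _ /=.
  by rewrite powRD_ge0 ?mulr_ge0 ?subr_ge0// -!powRrM ![a j * _]mulrC ![b j * _]mulrC.
rewrite big_split /= -!mulr_sumr.
have : (1 - t) * \sum_(y <- E) \prod_j f j (y *m Phi j) `^ a j <= (1 - t) * 1.
  by rewrite ler_wpM2l// subr_ge0.
have : t * \sum_(y <- E) \prod_j f j (y *m Phi j) `^ b j <= t * 1.
  by rewrite ler_wpM2l.
lra.
Qed.

Definition fractional (x : R) := 0 < x < 1.

(* With at most one fractional exponent, the condition on the common kernel of
   the maps with exponent 1 forces these maps to be jointly injective. *)
Lemma bl_integral s : (forall j, 0 <= s j <= 1) ->
  (forall i j, fractional (s i) -> fractional (s j) -> i = j) ->
  bl_cond s -> bl_ineq s.
Proof.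
move=> s01 frac1 cond; apply: bl_normalized => f f0 fS.
pose r := [seq j <- enum 'I_N | s j == 1].
pose W := (\bigcap_(j | s j == 1) kermx (Phi j))%MS.
have W1 j : s j == 1 -> W *m Phi j = 0.
  by move=> sj; apply/eqP; rewrite -sub_kermx (bigcapmx_inf j).
have W0 : \rank W = 0%N.
  (* In the condition at [W], exponents 0 contribute nothing and maps with exponent 1 kill [W]. What
     remains is at most s rank W with s < 1, which forces rank W = 0. *)
  have sW j : s j * (\rank (W *m Phi j))%:R <=
      (if fractional (s j) then s j * (\rank W)%:R else 0).
    have /andP[s0 s1] := s01 j; case: ifPn => [_|].
      by rewrite ler_wpM2l// ler_nat mxrankM_maxl.
    rewrite /fractional negb_and -!leNgt => /orP[s0'|s1'].
      by have -> : s j = 0 by [apply/eqP; rewrite eq_le s0 s0']; rewrite mul0r.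
    by rewrite W1 ?mxrank0 ?mulr0// eq_le s1 s1'.
  have := le_trans (cond W) (ler_sum _ (fun j _ => sW j)).
  rewrite -big_mkcond /=; case: (pickP (fun j => fractional (s j))) => [j0 fj0|nof].
    rewrite (big_pred1 j0); last first.
      by move=> j /=; apply/idP/eqP => [fj|->//]; exact: frac1.
    move: fj0 => /andP[_ sj0]; case: (\rank W) => // k.
    by rewrite ler_pMl ?ltr0Sn// leNgt sj0.
  by rewrite big_pred0//; case: (\rank W) => // k; rewrite leNgt ltr0Sn.
move=> E uE.
apply: (@le_trans _ _ (\sum_(y <- E) \prod_(j <- r) f j (y *m Phi j))).
  apply: ler_sum => y _; rewrite big_filter big_enum_cond /= [leRHS]big_mkcond /=.
  apply: ler_prod => j _; rewrite powR_ge0 /=; case: eqP => [->|_].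
    by rewrite powRr1.
  by rewrite powR_le1//; [exact: sum_le_at (fS j) | case/andP: (s01 j)].
suff : \sum_(y <- E) \prod_(j <- r) f j (y *m Phi j) <= \prod_(j <- r) (1 : R).
  by move/le_trans; apply; rewrite big1.
apply: (@sum_le_prod R _ _ (fun j => 'rV[F]_(m j)) (fun j y => y *m Phi j) _ (fun=> 1)) => //.
move=> x y _ _ xy; apply/eqP; rewrite -subr_eq0.
have : ((x - y) <= W)%MS.
  apply/sub_bigcapmxP => j sj; rewrite sub_kermx mulmxBl xy ?subrr//.
  by rewrite mem_filter sj mem_enum.
move/mxrankS; rewrite W0 leqn0 mxrank_eq0 => /eqP ->; exact/eqP.
Qed.

End Fixed.
End BrascampLieb.

(** * Splitting along a critical subspace *)

Section Critical.
Variables (R : realType) (F : fieldType) (N n : nat) (m : 'I_N -> nat).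
Variables (Phi : forall j, 'M[F]_(n, m j)) (s : 'I_N -> R) (W : 'M[F]_n).
Hypothesis cond : bl_cond Phi s.
Hypothesis crit : (\rank W)%:R = \sum_j s j * (\rank (W *m Phi j))%:R.

(** [A] and [B] are bases of [W] and of a complement. The complement stands for the quotient by [W],
    and the cokernel factor makes [PhiQ j] the map induced modulo the image of [W]. *)
Let A := row_base W.
Let B := row_base (W^C)%MS.
Let PhiW j := A *m Phi j.
Let PhiQ j := B *m Phi j *m cokermx (W *m Phi j).

Let AW : (A :=: W)%MS. Proof. exact: eq_row_base. Qed.
Let BW : (B :=: W^C)%MS. Proof. exact: eq_row_base. Qed.

Lemma bl_cond_sub : bl_cond PhiW s.
Proof.
move=> U; rewrite -(mxrankMfree U (row_base_free W)).
apply: le_trans (bl_cond_mx _ cond) _.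
by apply: ler_sum => j _; rewrite /PhiW mulmxA.
Qed.

(** Apply the condition to the preimage [X] of [U]: ranks add up in the source and in every target,
    and the equality at [W] cancels the contribution of [W]. *)
Lemma bl_cond_quo : bl_cond PhiQ s.
Proof.
move=> U; pose X := (U *m B + W)%MS.
have rX : \rank X = (\rank U + \rank W)%N.
  rewrite /X mxrank_disjoint_sum ?(mxrankMfree U (row_base_free _))//.
  apply/eqP; rewrite -submx0.
  apply: submx_trans (capmxS (submxMl U B) (submx_refl W)) _.
  by rewrite (cap_eqmx BW (eqmx_refl W)) capmxC capmx_compl.
have rXj j : \rank (X *m Phi j) = (\rank (U *m PhiQ j) + \rank (W *m Phi j))%N.
  rewrite -(mxrank_mul_ker (X *m Phi j) (cokermx (W *m Phi j))).
  congr (_ + _)%N.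
    rewrite (eqmxMr _ (addsmxMr _ _ _)) addsmxMr mulmx_coker addsmx0.
    by rewrite /PhiQ !mulmxA.
  suff e : (X *m Phi j :&: kermx (cokermx (W *m Phi j)) :=: W *m Phi j)%MS.
    by rewrite e.
  apply/eqmxP/andP; split.
    apply: submx_trans (capmxSr _ _) _.
    by rewrite submxE mulmx_ker.
  by rewrite sub_capmx submxMr ?addsmxSr// sub_kermx mulmx_coker eqxx.
have := bl_cond_mx X cond; rewrite rX natrD crit.
under [in leRHS]eq_bigr => j _ do rewrite rXj natrD mulrDr.
by rewrite big_split lerD2r.
Qed.

(* Sum first over the cosets of W, where the subspace inequality applies to
   translates of the f_j, then over the quotient. *)
Lemma bl_critical : bl_ineq PhiW s -> bl_ineq PhiQ s -> bl_ineq Phi s.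
Proof.
move=> blW blQ f S f0 fS E uE.
pose C := col_mx A B.
have CT (y : 'rV_n) : (y <= C)%MS.
  rewrite -addsmxE (adds_eqmx AW BW) submx_full//.
  exact: addsmx_compl_full.
(* [q1] and [q2] are the coordinates along [W] and along the complement. *)
pose q1 (y : 'rV[F]_n) := lsubmx (y *m pinvmx C).
pose q2 (y : 'rV[F]_n) := rsubmx (y *m pinvmx C).
have yE y : y = q1 y *m A + q2 y *m B.
  by rewrite -mul_row_col hsubmxK mulmxKpV.
(* Only the finitely many values met on [E] matter, which keeps the fibre sums [h j] finite. *)
pose D j := undup [seq y *m Phi j | y <- E].
pose h j (z' : 'rV[F]_(m j)) :=
  \sum_(z <- D j | z *m cokermx (W *m Phi j) == z') f j z.
have h0 j z : 0 <= h j z by apply: sumr_ge0.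
have hS j : sum_le (h j) (S j).
  by apply: sum_le_pushforward => //; exact: undup_uniq.
apply: le_trans (blQ h S h0 hS _ (undup_uniq (map q2 E))).
rewrite (partition_big_seq q2); apply: ler_sum => u _.
pose c j := u *m B *m Phi j.
(* On the coset of [u], this is [f j] translated by [c j] and cut down to the image of [W]; its
   total is part of the fibre sum [h j (u *m PhiQ j)]. *)
pose g j (z : 'rV[F]_(m j)) :=
  if (z <= W *m Phi j)%MS && (z + c j \in D j) then f j (z + c j) else 0.
have g0 j z : 0 <= g j z by rewrite /g; case: ifP.
have gS j : sum_le (g j) (h j (u *m PhiQ j)).
  move=> L uL; rewrite /g -big_mkcond /= -big_filter.
  rewrite -(big_map (fun z => z + c j) predT (f j)) /h -[leRHS]big_filter.
  apply: ler_sum_sub => //.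
    by rewrite map_inj_uniq ?filter_uniq//; exact: addIr.
  move=> z /mapP[w]; rewrite !mem_filter => /andP[/andP[wW wD] _] ->.
  rewrite wD andbT mulmxDl /c /PhiQ mulmxA -!mulmxA.
  move/submxP: wW => [v ->]; rewrite -!mulmxA [W *m (_ *m _)]mulmxA.
  by rewrite mulmx_coker mulmx0 add0r.
rewrite -[leLHS]big_filter.
pose E' := [seq y <- E | q2 y == u].
have uq1 : uniq (map q1 E').
  rewrite map_inj_in_uniq ?filter_uniq// => x y.
  rewrite !mem_filter => /andP[/eqP xu _] /andP[/eqP yu _] xy.
  by rewrite (yE x) (yE y) xy xu yu.
have := blW g _ g0 gS _ uq1; rewrite big_map; apply: le_trans.
rewrite big_seq [leRHS]big_seq; apply: ler_sum => y.
rewrite mem_filter => /andP[/eqP yu yE'].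
rewrite le_eqVlt; apply/orP; left; apply/eqP; apply: eq_bigr => j _; congr (_ `^ _).
have e : q1 y *m PhiW j + c j = y *m Phi j.
  by rewrite [in RHS](yE y) yu mulmxDl /c /PhiW mulmxA.
rewrite /g e /D mem_undup (map_f (fun y => y *m Phi j) yE') andbT ifT//.
by rewrite /PhiW mulmxA submxMr// -AW submxMl.
Qed.

End Critical.

(** * Moving the exponents, and the induction *)

Section BrascampLiebTheorem.
Variables (R : realType) (F : fieldType) (N : nat).

(** A pair [c] encodes the constraint [0 <= c.1 + t * c.2], valid at t = 0. Unless no slope is
    negative, some decreasing constraint is the first to become an equality as t grows. In the
    induction, a new constraint violated at the time found so far has an earlier zero, which
    replaces it. *)
Lemma first_tight_constraint (L : seq (R * R)) :
  (forall c, c \in L -> 0 <= c.1) ->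
  (forall c, c \in L -> 0 <= c.2) \/
  exists t, [/\ 0 <= t, forall c, c \in L -> 0 <= c.1 + t * c.2 &
    exists c, [/\ c \in L, c.2 < 0 & c.1 + t * c.2 = 0]].
Proof.
elim: L => [|c L IH] L0; first by left.
have c0 : 0 <= c.1 by apply: L0; rewrite mem_head.
have {}L0 d : d \in L -> 0 <= d.1 by move=> dL; apply: L0; rewrite in_cons dL orbT.
have tc : c.2 < 0 -> c.1 + c.1 / - c.2 * c.2 = 0.
  by move=> c2; field; rewrite lt_eqF.
have tc0 : c.2 < 0 -> 0 <= c.1 / - c.2.
  by move=> c2; rewrite divr_ge0// oppr_ge0 ltW.
have [Lp|[t [t0 tL [d [dL d2 dt]]]]] := IH L0.
  have [c2|c2] := leP 0 c.2.
    by left=> d; rewrite in_cons => /predU1P[->//|/Lp].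
  right; exists (c.1 / - c.2); split; first exact: tc0.
    move=> d; rewrite in_cons => /predU1P[->|dL]; first by rewrite tc.
    by rewrite addr_ge0 ?L0// mulr_ge0 ?tc0 ?Lp.
  by exists c; rewrite mem_head; split=> //; exact: tc.
right; have [ct|ct] := leP 0 (c.1 + t * c.2).
  exists t; split=> //.
    by move=> e; rewrite in_cons => /predU1P[->//|/tL].
  by exists d; rewrite in_cons dL orbT.
have c2 : c.2 < 0.
  rewrite ltNge; apply/negP => c2; move: ct; apply/negP; rewrite -leNgt.
  by rewrite addr_ge0// mulr_ge0.
have le_t : c.1 / - c.2 <= t.
  by rewrite ler_pdivrMr ?oppr_gt0//; move: ct; nra.
exists (c.1 / - c.2); split; first exact: tc0.
  move=> e; rewrite in_cons => /predU1P[->|eL]; first by rewrite tc.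
  have [e2|e2] := leP 0 e.2; first by rewrite addr_ge0 ?L0// mulr_ge0 ?tc0.
  apply: le_trans (tL e eL) _; rewrite lerD2l.
  by rewrite ler_wnM2r// ltW.
by exists c; rewrite mem_head; split=> //; exact: tc.
Qed.

Definition critical n (m : 'I_N -> nat) (Phi : forall j, 'M[F]_(n, m j))
    (s : 'I_N -> R) (W : 'M[F]_n) :=
  (0 < \rank W < n)%N /\ (\rank W)%:R = \sum_j s j * (\rank (W *m Phi j))%:R.

(** Follow the ray from [s] in the direction [v] up to the first tight constraint; there is one
    because [v i] is negative. *)
Lemma bl_move n (m : 'I_N -> nat) (Phi : forall j, 'M[F]_(n, m j))
    (s v : 'I_N -> R) (i j : 'I_N) :
  (forall k, 0 <= s k <= 1) -> bl_cond Phi s -> i != j ->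
  (forall k, k != i -> k != j -> v k = 0) -> v i < 0 ->
  \sum_k v k * (\rank (Phi k))%:R = 0 ->
  exists t, let s' := fun k => s k + t * v k in
    [/\ 0 <= t, forall k, 0 <= s' k <= 1, bl_cond Phi s' &
      (exists W, critical Phi s' W) \/
      exists2 k, k \in [:: i; j] & ~~ fractional (s' k)].
Proof.
move=> s01 cond ij v0 vi vPhi.
(* There may be infinitely many [W], but the constraint of [W] depends only on its ranks, which take
   finitely many values. *)
pose K := ('I_n.+1 * {ffun 'I_N -> 'I_n.+1})%type.
pose realized (k : K) := `[< exists W : 'M[F]_n, \rank W = k.1 :> nat /\
  forall l, \rank (W *m Phi l) = k.2 l :> nat >].
pose slack (k : K) := \sum_l s l * (k.2 l)%:R - (k.1)%:R.
pose rate (k : K) := \sum_l v l * (k.2 l)%:R.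
pose L := [seq (slack k, rate k) | k <- enum realized]
  (* The bounds 0 and 1 are imposed on the two moving exponents only. *)
  ++ [seq (s l, v l) | l <- [:: i; j]]
  ++ [seq (1 - s l, - v l) | l <- [:: i; j]].
have [c|Lp|[t [t0 tL tight]]] := @first_tight_constraint L.
- rewrite !mem_cat => /or3P[] /mapP[k].
  + rewrite mem_enum => /asboolP[W [W1 W2]] -> /=.
    rewrite subr_ge0 -W1; under eq_bigr do rewrite -W2; exact: cond.
  + by move=> _ ->; case/andP: (s01 k).
  + by move=> _ -> /=; rewrite subr_ge0; case/andP: (s01 k).
- have := Lp (s i, v i); rewrite !mem_cat map_f ?mem_head// orbT => /(_ isT) /=.
  by rewrite leNgt vi.
exists t => s'; split=> //.
- move=> k; have [kij|] := boolP (k \in [:: i; j]); last first.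
    rewrite !inE negb_or => /andP[ki kj].
    by rewrite /s' v0// mulr0 addr0.
  have := tL (s k, v k); rewrite !mem_cat (map_f (fun l => (s l, v l)) kij).
  have := tL (1 - s k, - v k).
  rewrite !mem_cat (map_f (fun l => (1 - s l, - v l)) kij) !orbT.
  by move=> /(_ isT) /= + /(_ isT) /= ->; rewrite mulrN -addrA -opprD subr_ge0.
- move=> W; have rW : (\rank W < n.+1)%N by rewrite ltnS rank_leq_row.
  have rWP l : (\rank (W *m Phi l) < n.+1)%N.
    by rewrite (leq_ltn_trans (mxrankM_maxl _ _)).
  pose k : K := (Ordinal rW, [ffun l => Ordinal (rWP l)]).
  have kr : k \in enum realized.
    by rewrite mem_enum; apply/asboolP; exists W; split=> // l; rewrite ffunE.
  have := tL (slack k, rate k).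
  rewrite mem_cat (map_f (fun k => (slack k, rate k)) kr) => /(_ isT) /=.
  rewrite /slack /rate mulr_sumr addrAC -big_split /= subr_ge0.
  move/le_trans; apply; rewrite le_eqVlt; apply/orP; left; apply/eqP.
  by apply: eq_bigr => l _; rewrite ffunE /s' mulrDl mulrA.
- case: tight => c []; rewrite !mem_cat => /or3P[] /mapP[k].
  + rewrite mem_enum => /asboolP[W [W1 W2]] -> /= rk sk; left; exists W.
    have sE : \sum_l s' l * (\rank (W *m Phi l))%:R = (\rank W)%:R :> R.
      apply/eqP; rewrite -subr_eq0 -[X in _ == X]sk /slack /rate mulr_sumr.
      rewrite addrAC -big_split /= W1; apply/eqP; congr (_ - _).
      by apply: eq_bigr => l _; rewrite W2 mulrDl mulrA.
    (* The tight constraint has negative slope, whereas the slope is 0 for rank 0, and also for rank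
       n by [vPhi]; so [W] is proper and nonzero. *)
    split=> //; rewrite lt0n; apply/andP; split.
      apply: contraTneq rk => W0; rewrite -leNgt /rate big1// => l _.
      have := mxrankM_maxl W (Phi l).
      by rewrite W0 leqn0 W2 => /eqP ->; rewrite mulr0.
    rewrite ltn_neqAle rank_leq_row andbT; apply: contraTneq rk => Wn.
    rewrite -leNgt -[leLHS]vPhi le_eqVlt; apply/orP; left; apply/eqP.
    apply: eq_bigr => l _; rewrite -W2 (eqmxMfull (Phi l))//.
    by rewrite /row_full Wn.
  + move=> kij -> /= _ sk; right; exists k => //.
    by rewrite /fractional /s' sk ltxx.
  + move=> kij -> /= _ sk; right; exists k => //.
    rewrite /fractional; have -> : s' k = 1.
      by apply/eqP; rewrite eq_sym -subr_eq0 -[X in _ == X]sk /s' opprD mulrN addrA.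
    by rewrite ltxx andbF.
Qed.

(** Two nested inductions: on the dimension, which settles exponents with a critical subspace, and
    then on the number of fractional exponents. *)
Theorem brascamp_lieb n (m : 'I_N -> nat) (Phi : forall j, 'M[F]_(n, m j))
    (s : 'I_N -> R) :
  (forall j, 0 <= s j <= 1) -> bl_cond Phi s -> bl_ineq Phi s.
Proof.
elim/ltn_ind: n m Phi s => n IHn m Phi s.
have bl_crit (s' : 'I_N -> R) W : (forall j, 0 <= s' j <= 1) ->
    bl_cond Phi s' -> critical Phi s' W -> bl_ineq Phi s'.
  move=> s01 cond [/andP[W0 Wn] crit]; apply: (bl_critical (W := W)).
    by apply: IHn => //; exact: bl_cond_sub.
  apply: IHn => //; last exact: bl_cond_quo.
  by rewrite mxrank_compl ltn_subrL W0 (leq_trans _ Wn).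
have [k] := ubnP #|[pred j | fractional (s j)]|.
elim: k s => // k IHk s sk s01 cond.
have IHs (s' : 'I_N -> R) l : (forall j, 0 <= s' j <= 1) -> bl_cond Phi s' ->
    (forall j, fractional (s' j) -> fractional (s j)) ->
    fractional (s l) -> ~~ fractional (s' l) -> bl_ineq Phi s'.
  move=> s'01 cond' sub sl s'l; apply: IHk => //.
  rewrite -ltnS; apply: leq_trans sk; rewrite ltnS; apply: proper_card.
  apply/properP; split; first by apply/fintype.subsetP => j; rewrite !inE; exact: sub.
  by exists l; rewrite inE.
have s0 j : 0 <= s j by case/andP: (s01 j).
(* A zero map does not enter the condition, so its exponent may be lowered to 0, and [bl_mono]
   brings it back. *)
have drop0 l : fractional (s l) -> \rank (Phi l) = 0%N -> bl_ineq Phi s.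
  move=> sl /eqP; rewrite mxrank_eq0 => /eqP Pl.
  pose s' j := if j == l then 0 else s j.
  apply: (@bl_mono _ _ _ _ _ _ s s').
    by move=> j; rewrite /s'; case: eqP; rewrite ?lexx s0.
  apply: (IHs s' l) => //.
  - by move=> j; rewrite /s'; case: eqP; rewrite ?lexx ?ler01.
  - move=> W; apply: le_trans (cond W) _; rewrite le_eqVlt; apply/orP; left.
    apply/eqP; apply: eq_bigr => j _; rewrite /s'; case: eqP => // ->.
    by rewrite Pl mulmx0 mxrank0 !mulr0.
  - by move=> j; rewrite /s'; case: eqP => // _; rewrite /fractional ltxx.
  - by rewrite /s' eqxx /fractional ltxx.
have [[i [j [ij si sj]]]|noij] :=
    pselect (exists i j, [/\ i != j, fractional (s i) & fractional (s j)]); last first.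
  apply: bl_integral => // i j si sj; apply: contra_notP noij => /eqP ij.
  by exists i, j.
have [Pi|Pi] := posnP (\rank (Phi i)); first exact: drop0 si Pi.
have [Pj|Pj] := posnP (\rank (Phi j)); first exact: drop0 sj Pj.
(* The inverse ranks keep the constraint of the whole space constant along [v]. *)
pose v l : R := if l == i then - (\rank (Phi i))%:R^-1
  else if l == j then (\rank (Phi j))%:R^-1 else 0.
have vi : v i < 0 by rewrite /v eqxx oppr_lt0 invr_gt0 ltr0n.
have vj : 0 < v j by rewrite /v eq_sym (negPf ij) eqxx invr_gt0 ltr0n.
have v0 l : l != i -> l != j -> v l = 0.
  by move=> /negPf li /negPf lj; rewrite /v li lj.
have vPhi : \sum_l v l * (\rank (Phi l))%:R = 0.
  rewrite (bigD1 i)//= (bigD1 j) 1?eq_sym//= big1 ?addr0; last first.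
    by move=> l /andP[li lj]; rewrite v0 ?mul0r.
  rewrite /v eqxx eq_sym (negPf ij) eqxx mulNr !mulVf ?addNr//.
    by rewrite pnatr_eq0 -lt0n.
  by rewrite pnatr_eq0 -lt0n.
have endpoint (w : 'I_N -> R) t : (forall l, l != i -> l != j -> w l = 0) ->
    let s' l := s l + t * w l in (forall l, 0 <= s' l <= 1) ->
    bl_cond Phi s' ->
    (exists W, critical Phi s' W) \/
      (exists2 l, l \in [:: i; j] & ~~ fractional (s' l)) -> bl_ineq Phi s'.
  move=> w0 s' s'01 cond' [[W crit]|[l lij s'l]]; first exact: bl_crit crit.
  apply: (IHs s' l) => // [h|].
    have [->|hi] := eqVneq h i; first by rewrite si.
    have [->|hj] := eqVneq h j; first by rewrite sj.
    by rewrite /s' w0// mulr0 addr0.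
  by move: lij; rewrite !inE => /orP[/eqP->|/eqP->].
have [t1 [t10 s1 cond1 /(endpoint v t1 v0 s1 cond1) bl1]] :=
  bl_move s01 cond ij v0 vi vPhi.
pose w l := - v l.
have w0 l : l != i -> l != j -> w l = 0 by move=> li lj; rewrite /w v0 ?oppr0.
have [||||t2 [t20 s2 cond2 tight2]] := @bl_move n m Phi s w j i s01 cond.
- by rewrite eq_sym.
- by move=> l lj li; exact: w0.
- by rewrite /w oppr_lt0.
- by under eq_bigr do rewrite mulNr; rewrite sumrN vPhi oppr0.
have bl2 : bl_ineq Phi (fun l => s l + t2 * w l).
  apply: endpoint => //; case: tight2 => [|[l lji sl]]; first by left.
  by right; exists l => //; rewrite !inE orbC; move: lji; rewrite !inE.
(* If neither move has positive length, [s] is itself an end point. *)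
have [t12|t12] := eqVneq (t1 + t2) 0.
  have t1z : t1 = 0 by lra.
  apply: bl_mono bl1 => l; have := s1 l.
  by rewrite /= t1z mul0r addr0 lexx => /andP[->].
have tp : 0 < t1 + t2 by rewrite lt0r t12 addr_ge0.
have := @bl_interp _ _ _ _ _ _ _ _ (t1 / (t1 + t2)) _ _ _ bl1 bl2.
(* The weights t2/(t1+t2) and t1/(t1+t2) cancel the opposite displacements t1 v and -t2 v. *)
have sE l : s l = (1 - t1 / (t1 + t2)) * (s l + t1 * v l)
    + t1 / (t1 + t2) * (s l + t2 * w l) by rewrite /w; field.
rewrite -(funext sE); apply.
- by move=> l; case/andP: (s1 l).
- by move=> l; case/andP: (s2 l).
- by rewrite divr_ge0 ?(ltW tp)//= ler_pdivrMr// mul1r lerDl.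
Qed.

End BrascampLiebTheorem.

(** * Subgroups of finitely generated abelian groups *)

Section Subgroups.
Variable A : zmodType.
Implicit Types (H : set A) (x y : A).

Lemma is_subgroupP H : is_subgroup H <->
  H 0 /\ (forall x y, H x -> H y -> H (x - y)).
Proof.
split=> [[H0 HB]|[H0 HB]]; split.
- by move: H0; rewrite inE.
- by move=> x y Hx Hy; have := HB x y; rewrite !inE; apply.
- by rewrite inE.
- by move=> x y; rewrite !inE; exact: HB.
Qed.

Lemma subgroup0 H : is_subgroup H -> H 0.
Proof. by move=> /is_subgroupP[]. Qed.

Lemma subgroupB H x y : is_subgroup H -> H x -> H y -> H (x - y).
Proof. by move=> /is_subgroupP[_]; apply. Qed.

Lemma subgroupN H x : is_subgroup H -> H x -> H (- x).
Proof. by move=> sH Hx; rewrite -sub0r; apply: subgroupB => //; exact: subgroup0. Qed.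

Lemma subgroupD H x y : is_subgroup H -> H x -> H y -> H (x + y).
Proof.
by move=> sH Hx Hy; rewrite -[y]opprK; apply: subgroupB => //; exact: subgroupN.
Qed.

Lemma subgroupMn H x n : is_subgroup H -> H x -> H (x *+ n).
Proof.
move=> sH Hx; elim: n => [|n IH]; first by rewrite mulr0n; exact: subgroup0.
by rewrite mulrS; exact: subgroupD.
Qed.

Lemma subgroupMz H x (c : int) : is_subgroup H -> H x -> H (x *~ c).
Proof.
move=> sH Hx; case: c => n; first exact: subgroupMn.
by rewrite NegzE mulrNz; apply: subgroupN => //; exact: subgroupMn.
Qed.

Lemma subgroup_sum H (I : Type) (r : seq I) (P : pred I) (F : I -> A) :
  is_subgroup H -> (forall i, P i -> H (F i)) -> H (\sum_(i <- r | P i) F i).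
Proof.
move=> sH HF; apply: (big_ind H) => //; first exact: subgroup0.
by move=> x y; exact: subgroupD.
Qed.

Lemma subgroupI H K : is_subgroup H -> is_subgroup K -> is_subgroup (H `&` K).
Proof.
move=> sH sK; apply/is_subgroupP; split; first by split; exact: subgroup0.
by move=> x y [Hx Kx] [Hy Ky]; split; exact: subgroupB.
Qed.

Lemma Zspan_sub r (b : 'I_r -> A) H :
  is_subgroup H -> (forall i, H (b i)) -> Zspan b `<=` H.
Proof.
move=> sH Hb _ [c _ <-]; apply: subgroup_sum => // i _; exact: subgroupMz.
Qed.

Lemma Zspan_subgroup r (b : 'I_r -> A) : is_subgroup (Zspan b).
Proof.
apply/is_subgroupP; split.
  by exists (fun=> 0) => //; rewrite big1// => i _; rewrite mulr0z.
move=> _ _ [c _ <-] [d _ <-]; exists (fun i => c i - d i) => //.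
by rewrite -sumrB; apply: eq_bigr => i _; rewrite mulrzBr.
Qed.

Lemma mem_Zspan r (b : 'I_r -> A) i : Zspan b (b i).
Proof.
exists (fun k => (k == i)%:R) => //; rewrite (bigD1 i)//= eqxx mulr1z big1 ?addr0//.
by move=> k /negPf ->; rewrite mulr0z.
Qed.

Definition Zcons r (a : A) (b : 'I_r -> A) (i : 'I_r.+1) :=
  oapp b a (unlift ord0 i).

Lemma Zcons0 r a (b : 'I_r -> A) : Zcons a b ord0 = a.
Proof. by rewrite /Zcons unlift_none. Qed.

Lemma Zcons_lift r a (b : 'I_r -> A) i : Zcons a b (lift ord0 i) = b i.
Proof. by rewrite /Zcons liftK. Qed.

(** Induction on n, by Euclidean division. An element [h0] of [H] with the least positive
    coefficient [d0] at the first generator reduces every other element of [H] into the span of the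
    remaining generators. If no positive coefficient occurs, [H] already lies in that span. *)
Lemma subgroup_finitely_spanned n (x : 'I_n -> A) H :
  is_subgroup H -> H `<=` Zspan x -> exists m (y : 'I_m -> A), H = Zspan y.
Proof.
elim: n x H => [|n IH] x H sH Hx.
  exists 0%N, x; rewrite eqEsubset; split=> // y [c _ <-].
  by rewrite big_ord0; exact: subgroup0.
pose x' i := x (lift ord0 i); pose H' := H `&` Zspan x'.
have sx' := Zspan_subgroup x'; have sH' : is_subgroup H' by exact: subgroupI.
have [m [y yH']] := IH x' H' sH' (@subIsetr _ _ _).
have Hsplit h : H h -> exists d : int, Zspan x' (h - x ord0 *~ d).
  move=> /Hx[c _ <-]; exists (c ord0); rewrite big_ord_recl addrC addKr.
  by exists (fun i => c (lift ord0 i)).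
(* The family [x] need not be free, so [d] is just one possible coefficient of [h]. *)
pose P d := `[< (0 < d)%N /\ exists2 h, H h & Zspan x' (h - x ord0 *+ d) >].
have [/ex_minnP[d0 /asboolP[d00 [h0 Hh0 h0x]] dmin]|noP] := pselect (exists d, P d).
  exists m.+1, (Zcons h0 y); rewrite eqEsubset; split; last first.
    apply: Zspan_sub => // i; case: (unliftP ord0 i) => [k|] ->.
      rewrite Zcons_lift; suff : H' (y k) by case.
      by rewrite yH'; exact: mem_Zspan.
    by rewrite Zcons0.
  move=> h Hh; have [d hd] := Hsplit h Hh.
  pose q := (d %/ d0%:Z)%Z; pose e := (d %% d0%:Z)%Z.
  have dE : d = q * d0%:Z + e by exact: divz_eq.
  have e_ge0 : 0 <= e by rewrite modz_ge0// gt_eqF// ltz_nat.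
  have e_lt : e < d0%:Z by rewrite ltz_pmod.
  clearbody q e.
  have hq : Zspan x' (h - h0 *~ q - x ord0 *~ e).
    have -> : h - h0 *~ q - x ord0 *~ e =
        (h - x ord0 *~ d) - (h0 - x ord0 *+ d0) *~ q.
      rewrite pmulrn dE mulrzDr [q * _]mulrC mulrzA mulrzBl opprB opprD !addrA.
      by rewrite [h - x ord0 *~ _ *~ _ - _]addrAC subrK addrAC.
    by apply: subgroupB => //; exact: subgroupMz.
  have Hhq : H (h - h0 *~ q) by apply: subgroupB => //; exact: subgroupMz.
  have e0 : e = 0.
    case: e e_ge0 e_lt hq {dE} => // -[//|k] _; rewrite ltz_nat => kd hq.
    have /dmin : P k.+1 by apply/asboolP; split=> //; exists (h - h0 *~ q).
    by rewrite leqNgt kd.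
  have : H' (h - h0 *~ q) by split=> //; rewrite -[_ - _]subr0 -[0](mulr0z (x ord0)) -e0.
  rewrite yH' => hy; have sy := Zspan_subgroup (Zcons h0 y).
  rewrite -(subrK (h0 *~ q) h); apply: subgroupD => //.
    apply: (Zspan_sub (b := y)) hy => // k.
    by rewrite -(Zcons_lift h0 y); exact: mem_Zspan.
  by apply: subgroupMz => //; rewrite -{2}(Zcons0 h0 y); exact: mem_Zspan.
exists m, y; rewrite -yH' eqEsubset; split=> [h Hh|h []//]; split=> //.
have [d hd] := Hsplit h Hh.
case: d hd => [[|k]|k] hd; first by rewrite mulr0z subr0 in hd.
  by case: noP; exists k.+1; apply/asboolP; split=> //; exists h.
case: noP; exists k.+1; apply/asboolP; split=> //; exists (- h).
  exact: subgroupN.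
by move: (subgroupN sx' hd); rewrite NegzE mulrNz opprK opprD.
Qed.

Lemma finitely_generated_Zspan : finitely_generated A ->
  exists n (x : 'I_n -> A), [set: A] = Zspan x.
Proof.
move=> [S /finite_seqP[l ->] gen].
exists (size l), (tnth (in_tuple l)).
rewrite eqEsubset; split=> //; rewrite -gen; apply: smallest_sub.
  exact: Zspan_subgroup.
move=> a /= al; have /tnthP[i ->] : a \in in_tuple l by []; exact: mem_Zspan.
Qed.

Lemma torsion_subgroup H : is_subgroup H -> is_subgroup (torsion_part H).
Proof.
move=> sH; apply/is_subgroupP; split.
  by split; [exact: subgroup0 | exists 1%N].
move=> x y [Hx [n n0 xn]] [Hy [k k0 yk]]; split; first exact: subgroupB.
exists (n * k)%N; first by rewrite muln_gt0 n0.
by rewrite mulrnBl mulrnA xn mul0rn mulnC mulrnA yk mul0rn subrr.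
Qed.

End Subgroups.

(** * Free and torsion parts, by the Smith normal form *)

Section Structure.
Variable A : zmodType.
Implicit Types (H : set A).

Definition lincomb n (y : 'I_n -> A) (c : 'rV[int]_n) : A :=
  \sum_i y i *~ c 0 i.

Lemma lincombB n (y : 'I_n -> A) c d :
  lincomb y (c - d) = lincomb y c - lincomb y d.
Proof. by rewrite -sumrB; apply: eq_bigr => i _; rewrite !mxE mulrzBr. Qed.

Lemma lincomb_mul n k (y : 'I_n -> A) (c : 'rV_k) (M : 'M[int]_(k, n)) :
  lincomb y (c *m M) = lincomb (fun j => lincomb y (row j M)) c.
Proof.
rewrite /lincomb (eq_bigr (fun i => \sum_j y i *~ (M j i) *~ c 0 j)); last first.
  move=> i _; rewrite mxE mulrz_sumr; apply: eq_bigr => j _.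
  by rewrite mulrC mulrzA.
rewrite exchange_big /=; apply: eq_bigr => j _.
by rewrite mulrz_suml; apply: eq_bigr => i _; rewrite mxE.
Qed.

Lemma ZspanE n (y : 'I_n -> A) x : Zspan y x <-> exists c, x = lincomb y c.
Proof.
split=> [[c _ <-]|[c ->]]; last by exists (fun i => c 0 i).
by exists (\row_i c i); apply: eq_bigr => i _; rewrite mxE.
Qed.

(** The relations between the generators form a finitely generated lattice [K]. Smith's normal form
    yields new generators [z] whose relations are spanned by the rows of a diagonal matrix [D]: each
    [z j] is either free of relations or torsion. *)
Lemma finitely_spanned_free_part H m (y : 'I_m -> A) : H = Zspan y ->
  exists r (b : 'I_r -> A), free_part_basis H b.
Proof.
move=> HE; have sH : is_subgroup H by rewrite HE; exact: Zspan_subgroup.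
pose K := [set c : 'rV[int]_m | lincomb y c = 0].
have sK : is_subgroup K.
  apply/is_subgroupP; split; first by rewrite /K /= -(subrr 0) lincombB subrr.
  by move=> c d; rewrite /K /= lincombB => -> ->; rewrite subrr.
have [q [g KE]] : exists q (g : 'I_q -> 'rV[int]_m), K = Zspan g.
  apply: (@subgroup_finitely_spanned _ m (fun i => delta_mx 0 i)) => // c _.
  exists (fun i => c 0 i) => //; rewrite [RHS]row_sum_delta.
  by apply: eq_bigr => i _; rewrite -scaler_int intz.
have [L Lu [T Tu [d _ ME]]] := int_Smith_normal_form (\matrix_i g i).
pose D : 'M[int]_(q, m) := \matrix_(i, j) (d`_i *+ (i == j :> nat)).
rewrite -/D in ME.
pose z j := lincomb y (row j T).
have zc c : lincomb z c = lincomb y (c *m T) by rewrite lincomb_mul.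
have relP c : lincomb z c = 0 <-> exists a : 'rV_q, c = a *m D.
  rewrite zc; have -> : (lincomb y (c *m T) = 0) = K (c *m T) by [].
  have -> : K (c *m T) <-> exists a : 'rV_q, c *m T = a *m \matrix_i g i.
    rewrite KE; split=> [[a _ <-]|[a ->]].
      exists (\row_i a i); rewrite mulmx_sum_row; apply: eq_bigr => i _.
      by rewrite rowK mxE -scaler_int intz.
    exists (fun i => a 0 i) => //; rewrite mulmx_sum_row; apply: eq_bigr => i _.
    by rewrite rowK -scaler_int intz.
  rewrite ME; split=> [[a]|[a ->]].
    by rewrite !mulmxA => /(can_inj (mulmxK Tu)) ->; exists (a *m L).
  by exists (a *m invmx L); rewrite !mulmxA mulmxKV.
have zH j : H (z j) by rewrite HE; apply/ZspanE; exists (row j T).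
(* A zero column arises from a zero diagonal entry, or from an index beyond the number of rows. *)
pose free := [pred j : 'I_m | [forall i, D i j == 0]].
have ztor j : ~~ free j -> torsion_part H (z j).
  rewrite inE negb_forall => /existsP[i]; rewrite mxE.
  case: (eqVneq (i : nat) j) => [ij|_]; last by rewrite mulr0n eqxx.
  rewrite mulr1n => di; split=> //; exists (absz d`_i); first by rewrite absz_gt0.
  have : lincomb z (delta_mx 0 i *m D) = 0 by apply/relP; exists (delta_mx 0 i).
  rewrite -rowE /lincomb (bigD1 j)//= big1 ?addr0.
    rewrite !mxE ij eqxx mulr1n -ij; case: (d`_i) => k // /eqP.
    by rewrite NegzE mulrNz oppr_eq0 => /eqP.
  move=> k kj; rewrite !mxE ij.
  case: (eqVneq (j : nat) k) => [jk|_]; last by rewrite mulr0n mulr0z.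
  by case/eqP: kj; apply: val_inj.
pose b (i : 'I_#|free|) := z (enum_val i).
have freeE (c : 'I_m -> int) :
    \sum_(j | free j) z j *~ c j = \sum_(i < #|free|) b i *~ c (enum_val i).
  exact: (@big_enum_val _ _ _ _ free (fun j => z j *~ c j)).
exists #|free|, b; split.
  move=> c c0 i.
  pose c' j := \sum_(i | enum_val i == j :> 'I_m) c i.
  have c'E i' : c' (enum_val i') = c i'.
    rewrite /c' (big_pred1 i')// => k /=; apply/eqP/eqP => [/enum_val_inj//|->//].
  have : lincomb z (\row_j if free j then c' j else 0) = 0.
    rewrite /lincomb (bigID free)/= [X in _ + X]big1 ?addr0; last first.
      by move=> j /negPf fj; rewrite mxE fj mulr0z.
    rewrite -[RHS]c0 (eq_bigr (fun j => z j *~ c' j)); last first.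
      by move=> j fj; rewrite mxE fj.
    by apply: etrans (freeE c') _; apply: eq_bigr => k _; rewrite c'E.
  move/relP => [a /rowP/(_ (enum_val i))].
  have fi : free (enum_val i) by have := enum_valP i.
  rewrite mxE fi c'E => ->; rewrite mxE big1// => k _.
  by move/forallP: fi => /(_ k)/eqP ->; rewrite mulr0.
have sT := torsion_subgroup sH.
rewrite eqEsubset; split=> x Hx.
  have /ZspanE[c ->] : Zspan y x by rewrite -HE.
  have -> : lincomb y c = lincomb z (c *m invmx T) by rewrite zc mulmxKV.
  set e := c *m _; exists (\sum_(j | free j) z j *~ e 0 j).
    by exists (fun i => e 0 (enum_val i)) => //; rewrite -(freeE (e 0)).
  exists (\sum_(j | ~~ free j) z j *~ e 0 j).
    by apply: subgroup_sum => // j /ztor; exact: subgroupMz.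
  by rewrite /lincomb [RHS](bigID free).
case: Hx => u bu [t [Ht _] <-]; apply: subgroupD => //.
by apply: (Zspan_sub (b := b)) bu => // i; exact: zH.
Qed.

(** Subgroups are finitely spanned, hence have a free part: the default value in [rank] is not what
    is returned here. *)
Lemma rankP H : finitely_generated A -> is_subgroup H ->
  exists b : 'I_(rank H) -> A, free_part_basis H b.
Proof.
move=> /finitely_generated_Zspan[n [x AE]] sH.
have [m [y HE]] : exists m (y : 'I_m -> A), H = Zspan y.
  by apply: (@subgroup_finitely_spanned _ n x) => //; rewrite -AE.
have := finitely_spanned_free_part HE => -[r rb].
exact: (@xgetPex _ 0%N [set r | exists b : 'I_r -> A, free_part_basis H b]
  (ex_intro _ r rb)).
Qed.

(** The torsion part is finitely spanned; multiply together positive integers that annihilate its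
    generators. *)
Lemma torsion_exponent H : finitely_generated A -> is_subgroup H ->
  exists n (y : 'I_n -> A) (M : nat), [/\ (0 < M)%N, torsion_part H = Zspan y &
    forall x, torsion_part H x -> x *+ M = 0].
Proof.
move=> /finitely_generated_Zspan[n [x AE]] sH.
have sT := torsion_subgroup sH.
have [m [y TE]] : exists m (y : 'I_m -> A), torsion_part H = Zspan y.
  by apply: (@subgroup_finitely_spanned _ n x) => //; rewrite -AE.
have /choice[e eP] i : exists e : nat, (0 < e)%N /\ y i *+ e = 0.
  have : torsion_part H (y i) by rewrite TE; exact: mem_Zspan.
  by case=> _ [e e0 ye]; exists e.
exists m, y, (\prod_i e i)%N; split=> //.
  by rewrite prodn_gt0// => i; case: (eP i).
move=> w; rewrite TE => -[c _ <-].
rewrite -sumrMnl big1// => i _; rewrite (bigD1 i)//= pmulrn mulrzAC -pmulrn.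
by rewrite mulrnA; have [_ ->] := eP i; rewrite mul0rn mul0rz.
Qed.

End Structure.

(** * Coordinates in the tensor product with Q *)

Section RationalCoordinates.

Lemma clear_denominators n (v : 'rV[rat]_n) :
  exists N (z : 'I_n -> int), (0 < N)%N /\ v *+ N = \row_i (z i)%:~R.
Proof.
pose N := (\prod_k absz (denq (v 0%R k)))%N.
have /choice[z zP] i : exists zi : int, v 0 i *+ N = zi%:~R.
  exists (numq (v 0 i) * (\prod_(k | k != i) absz (denq (v 0%R k)))%N%:Z).
  rewrite /N (bigD1 i)//= -mulr_natr natrM mulrA intrM; congr (_ * _).
  by rewrite pmulrn absz_denq -{1}(divq_num_den (v 0 i)) divfK// intr_eq0 denq_neq0.
exists N, z; split; last by apply/rowP => i; rewrite mulmxnE mxE zP.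
by rewrite prodn_gt0// => i; rewrite absz_gt0 denq_neq0.
Qed.

Lemma rowV_mulrn_eq0 n (v : 'rV[rat]_n) (k : nat) : (0 < k)%N -> v *+ k = 0 -> v = 0.
Proof.
move=> k0 /eqP; rewrite -scaler_nat scaler_eq0 pnatr_eq0 -leqn0 leqNgt k0 /=.
by move/eqP.
Qed.

Variable A : zmodType.
Implicit Types (H : set A).

(** [pi] is the map from A to A tensor Q, written in the basis [b] of a free part; its kernel is the
    torsion. *)
Definition rational_coords r (b : 'I_r -> A) (pi : {additive A -> 'rV[rat]_r}) :=
  (forall i, pi (b i) = delta_mx 0 i) /\
  forall x, exists c t, [/\ x = \sum_i b i *~ c i + t,
    pi x = \row_i (c i)%:~R & torsion_part [set: A] t].

Lemma additive_torsion r (psi : {additive A -> 'rV[rat]_r}) H t :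
  torsion_part H t -> psi t = 0.
Proof.
move=> [_ [n n0 tn]]; apply: (rowV_mulrn_eq0 n0).
by rewrite -raddfMn tn raddf0.
Qed.

Lemma Zfree_torsion r (b : 'I_r -> A) (c : 'I_r -> int) n : Zfree b ->
  (0 < n)%N -> (\sum_i b i *~ c i) *+ n = 0 -> forall i, c i = 0.
Proof.
move=> bfree n0 cn i; suff /eqP : c i * n%:Z = 0.
  by rewrite mulf_eq0 => /orP[/eqP//|]; rewrite eqz_nat -leqn0 leqNgt n0.
apply: (bfree (fun i => c i * n%:Z)); rewrite -[RHS]cn -sumrMnl.
by apply: eq_bigr => k _; rewrite mulrzA pmulrn.
Qed.

(** Choose coordinates of each element modulo torsion. The additivity defect is a torsion
    combination of [b], which is zero since [b] is free. *)
Lemma rational_coords_exist : finitely_generated A ->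
  exists r (b : 'I_r -> A) (pi : {additive A -> 'rV[rat]_r}),
    rational_coords b pi.
Proof.
move=> fgA; have sT : is_subgroup [set: A] by apply/is_subgroupP.
have [b [bfree bT]] := rankP fgA sT; exists (rank [set: A]), b.
have sTor := torsion_subgroup sT.
have /choice[c cP] x : exists c : 'I_(rank [set: A]) -> int,
    torsion_part [set: A] (x - \sum_i b i *~ c i).
  have : [set: A] x by []; rewrite {1}bT => -[u [c _ <-] [t tt <-]].
  by exists c; rewrite addrC addrA addNr add0r.
pose pi x : 'rV[rat]_(rank [set: A]) := \row_i (c x i)%:~R.
have piB : zmod_morphism pi.
  move=> x y; apply/rowP => i; rewrite !mxE -rmorphB; congr (_%:~R).
  apply/eqP; rewrite -subr_eq0; apply/eqP.
  have [_ [n n0 tn]] := subgroupB sTor (subgroupB sTor (cP x) (cP y)) (cP (x - y)).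
  apply: (Zfree_torsion (c := fun i => c (x - y) i - (c x i - c y i)) bfree n0 _ i).
  rewrite -[RHS]tn; congr (_ *+ _).
  rewrite [x - _ - _](_ : _ = x - y - (\sum_i b i *~ c x i - \sum_i b i *~ c y i)).
    rewrite [- (_ - \sum_i b i *~ c (x - y) i)]opprB [RHS]addrC addrA subrK.
    by rewrite -!sumrB; apply: eq_bigr => k _; rewrite !mulrzBr.
  by rewrite !opprD !opprK addrACA.
pose piA : {additive A -> 'rV[rat]_(rank [set: A])} :=
  HB.pack pi (GRing.isZmodMorphism.Build _ _ pi piB).
exists piA; split=> [i|x]; last first.
  exists (c x), (x - \sum_i b i *~ c x i); split=> //.
  by rewrite addrC subrK.
apply/rowP => k; rewrite !mxE eqxx /=.
suff -> : c (b i) k = (k == i)%:R by case: (k == i).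
have [_ [n n0 tn]] := cP (b i).
apply/eqP; rewrite eq_sym -subr_eq0; apply/eqP.
apply: (Zfree_torsion (c := fun k => (k == i)%:R - c (b i) k) bfree n0 _ k).
rewrite -[RHS]tn; congr (_ *+ _).
rewrite (eq_bigr (fun k => b k *~ (k == i)%:R - b k *~ c (b i) k)); last first.
  by move=> l _; rewrite mulrzBr.
rewrite sumrB (bigD1 i)//= eqxx mulr1z big1 ?addr0// => l /negPf ->.
by rewrite mulr0z.
Qed.

Lemma rational_coords_comp r (b : 'I_r -> A) (pi : {additive A -> 'rV[rat]_r})
    k (psi : {additive A -> 'rV[rat]_k}) x : rational_coords b pi ->
  psi x = pi x *m \matrix_i psi (b i).
Proof.
move=> [_ /(_ x)[c [t [-> -> tt]]]].
rewrite raddfD/= (additive_torsion psi tt) addr0 mulmx_sum_row raddf_sum.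
by apply: eq_bigr => i _; rewrite mxE rowK raddfMz scaler_int.
Qed.

(** The hypotheses say that [pi] maps [H] into the row space of [W] and reaches a positive multiple
    of each row, so the images of a basis of the free part of [H] span that row space. *)
Lemma rank_mxrank r (b : 'I_r -> A) (pi : {additive A -> 'rV[rat]_r}) H
    k (W : 'M[rat]_(k, r)) :
  finitely_generated A -> rational_coords b pi -> is_subgroup H ->
  (forall x, H x -> (pi x <= W)%MS) ->
  (forall i, exists h N, [/\ H h, (0 < N)%N & pi h = row i W *+ N]) ->
  rank H = \rank W.
Proof.
move=> fgA [_ coord] sH HW WH; have [b' [b'free b'H]] := rankP fgA sH.
pose V := \matrix_i pi (b' i).
have Hb' i : H (b' i).
  rewrite b'H; exists (b' i); first exact: mem_Zspan.
  by exists 0; rewrite ?addr0//; apply: subgroup0; exact: torsion_subgroup.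
have piE c : pi (\sum_i b' i *~ c i) = (\row_i (c i)%:~R) *m V.
  rewrite mulmx_sum_row raddf_sum; apply: eq_bigr => i _.
  by rewrite mxE rowK raddfMz scaler_int.
have Vfree : row_free V.
  (* Cleared of denominators, a relation between the rows of [V] gives a combination of [b'] killed
     by [pi], hence torsion, hence with zero coefficients. *)
  rewrite -kermx_eq0; apply/rowV0P => u; rewrite sub_kermx => /eqP uV.
  have [N [z [N0 uz]]] := clear_denominators u.
  have : pi (\sum_i b' i *~ z i) = 0.
    by rewrite piE -uz -scaler_nat -scalemxAl uV scaler0.
  have [c [t [zt -> [_ [n n0 tn]]]]] := coord (\sum_i b' i *~ z i) => /rowP c0.
  have {}c0 i : c i = 0.
    by apply/eqP; rewrite -(intr_eq0 rat); have := c0 i; rewrite !mxE => /eqP.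
  rewrite [\sum_i b i *~ _]big1 ?add0r in zt; last by move=> i _; rewrite c0 mulr0z.
  rewrite -zt in tn.
  apply: (rowV_mulrn_eq0 N0); rewrite uz; apply/rowP => i.
  by rewrite !mxE (Zfree_torsion b'free n0 tn).
have <- : \rank V = rank H by apply/eqP.
apply/eqP; rewrite eqn_leq; apply/andP; split; apply: mxrankS; apply/row_subP => i.
  by rewrite rowK; exact: HW.
have [h [N [Hh N0 hN]]] := WH i.
have -> : row i W = (N%:R)^-1 *: pi h.
  by rewrite hN -scaler_nat scalerA mulVf ?scale1r// pnatr_eq0 -lt0n.
apply: scalemx_sub.
have [u [c _ <-] [t tt <-]] : [set x + t | x in Zspan b' & t in torsion_part H] h.
  by rewrite -b'H.
by rewrite raddfD/= (additive_torsion pi tt) addr0 piE submxMl.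
Qed.

Lemma preimage_subgroup r (pi : {additive A -> 'rV[rat]_r}) k
    (W : 'M[rat]_(k, r)) : is_subgroup [set x | (pi x <= W)%MS].
Proof.
apply/is_subgroupP; split=> [|x y]; rewrite /= ?raddf0 ?sub0mx// raddfB.
by move=> xW yW; rewrite addmx_sub// eqmx_opp.
Qed.

Lemma rational_coords_lift r (b : 'I_r -> A) (pi : {additive A -> 'rV[rat]_r}) w :
  rational_coords b pi ->
  exists x N, (0 < N)%N /\ pi x = w *+ N.
Proof.
move=> [pib _]; have [N [z [N0 wz]]] := clear_denominators w.
exists (\sum_i b i *~ z i), N; split=> //; rewrite wz raddf_sum [RHS]row_sum_delta.
by apply: eq_bigr => i _; rewrite mxE /= raddfMz pib scaler_int.
Qed.

End RationalCoordinates.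

Lemma image_subgroup (A B : zmodType) (phi : {additive A -> B}) (H : set A) :
  is_subgroup H -> is_subgroup (phi @` H).
Proof.
move=> sH; apply/is_subgroupP; split.
  by exists 0; [exact: subgroup0|rewrite raddf0].
move=> _ _ [x Hx <-] [y Hy <-]; exists (x - y); last by rewrite raddfB.
exact: subgroupB.
Qed.

(** * Sums and norms *)

Section EsumSeq.
Variables (R : realType) (T : choiceType).
Local Open Scope ereal_scope.

Lemma fsbig_fset_seq (X : set T) (a : T -> \bar R) : finite_set X ->
  exists2 E : seq T, uniq E & \sum_(x \in X) a x = \sum_(x <- E) a x.
Proof.
move=> fX; exists (fset_set X); first exact: fset_uniq.
by rewrite fsbig_finite.
Qed.

Lemma esum_le_fin (f : T -> R) (M : R) : sum_le f M ->
  \esum_(y in [set: T]) (f y)%:E <= M%:E.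
Proof.
move=> fM; apply: ge_ereal_sup => _ [X [fX _] <-].
have [E uE ->] := fsbig_fset_seq (EFin \o f) fX.
by rewrite sumEFin lee_fin; exact: fM.
Qed.

Lemma sum_seq_le_esum (f : T -> R) (E : seq T) : uniq E ->
  (\sum_(y <- E) f y)%:E <= \esum_(y in [set: T]) (f y)%:E.
Proof.
move=> uE; apply: ereal_sup_ubound; exists [set` E].
  by split=> //; exact: finite_seq.
by rewrite -fsbig_seq// sumEFin.
Qed.

End EsumSeq.

Section EllNorm.
Variables (R : realType) (A : zmodType).
Local Open Scope ereal_scope.

Let mu : {measure set (discrete_zmod A) -> \bar R} := counting.

Lemma counting_seq (l : seq (discrete_zmod A)) : uniq l ->
  mu [set` l] = (size l)%:R%:E.
Proof.
move=> ul; rewrite /mu /= /counting asboolT; last exact: finite_seq.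
have -> : [set` l] = [set` [fset x in l]%fset] :> set (discrete_zmod A).
  by apply/seteqP; split=> x /=; rewrite inE.
by rewrite set_fsetK card_fseq undup_id.
Qed.

Lemma le_counting (X Y : set (discrete_zmod A)) : X `<=` Y -> mu X <= mu Y.
Proof. by move=> XY; apply: le_measure => //; exact: mem_set. Qed.

(** A null set for counting measure is empty, since a point has measure 1. *)
Lemma counting_ae (P : discrete_zmod A -> Prop) :
  (\forall x \ae mu, P x) -> forall x, P x.
Proof.
move=> [B [_ B0 PB]] x; apply: contrapT => /PB Bx.
have : mu [set` [:: x]] <= mu B by apply: le_counting => y /=; rewrite inE => /eqP ->.
by rewrite counting_seq// [mu B]B0 lee_fin ler10.
Qed.

Lemma sum_seq_le_integral (g : discrete_zmod A -> R) (D : seq A) :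
  (forall x, (0 <= g x)%R) -> uniq D ->
  (\sum_(z <- D) g z)%:E <= \int[mu]_x (g x)%:E.
Proof.
move=> g0 uD.
have -> : (\sum_(z <- D) g z)%:E =
    \int[mu]_x \sum_(z <- D) (g z * \1_[set` [:: z : discrete_zmod A]] x)%:E.
  rewrite ge0_integral_sum//; last by move=> z x _; rewrite lee_fin mulr_ge0.
  rewrite -sumEFin; apply: eq_bigr => z _.
  under eq_integral do rewrite EFinM.
  rewrite ge0_integralZl// ?lee_fin//.
  by rewrite integral_indic// setIT counting_seq// mule1.
apply: ge0_le_integral => //.
  by move=> x _; apply: sume_ge0 => z _; rewrite lee_fin mulr_ge0.
move=> x _; rewrite sumEFin lee_fin.
rewrite (eq_bigr (fun z => if x == z then g z else 0%R)); last first.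
  move=> z _; rewrite indicE mem_setE /= inE.
  by case: (x == z); rewrite ?mulr1 ?mulr0.
by rewrite -big_mkcond sum_pred1_seq//; case: ifP.
Qed.

(** Equality holds for finite [p]; for infinite [p] the bound is 1, while the norm is 0 when [l] is
    empty. *)
Lemma ell_norm_indicator (p : \bar R) (l : seq A) : 1 <= p -> uniq l ->
  ell_norm p (fun x => (x \in l)%:R%R) <= ((size l)%:R `^ fine p^-1)%:E.
Proof.
move=> p1 ul; rewrite /ell_norm unlock; case: p p1 => [p p1|_|//]; last first.
  rewrite invey /= powRr0; case: ifP => [mu0|_]; last by rewrite lee_fin.
  apply/ess_supP/nearW => x /=.
  by rewrite lee_fin ger0_norm; case: (x \in l).
rewrite lee_fin in p1; have p0 : (0 < p)%R by rewrite (lt_le_trans _ p1).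
have -> : \int[mu]_x `|(EFin \o (fun x : A => (x \in l)%:R%R)) x| `^ p = (size l)%:R%:E.
  rewrite -counting_seq// -[in RHS](setIT [set` _]) -integral_indic//.
  apply: eq_integral => x _ /=; rewrite indicE mem_setE /=.
  by case: (x \in l); rewrite ?normr1 ?powR1 // normr0 powR0// gt_eqF.
by rewrite inver gt_eqF.
Qed.

(** A common form for all exponents. For finite [p], take F = f^p, c = 1 and S = m^p. For infinite
    [p], take F = 0, c = m and S = 1: the exponent is then 0, and 0 to the power 0 is 1. *)
Lemma ell_norm_sum_le (p : \bar R) (f : A -> R) (m : R) : 1 <= p ->
  (forall x, (0 <= f x)%R) -> ell_norm p f = m%:E ->
  exists (F : A -> R) (c S : R), [/\ forall x, (0 <= F x)%R, (0 <= c)%R,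
    sum_le F S, forall x, (f x <= c * F x `^ fine p^-1)%R &
    (c * S `^ fine p^-1)%R = m].
Proof.
move=> p1 f0; have := Lnorm_ge0 mu p (EFin \o f); rewrite -/(ell_norm p f).
move=> + E; rewrite E lee_fin => m0; move: E.
rewrite /ell_norm unlock; case: p p1 => [p p1|_|//]; last first.
  have muT : 0 < mu [set: discrete_zmod A].
    apply: (@lt_le_trans _ _ (mu [set` [:: 0%R]])); first by rewrite counting_seq.
    exact: le_counting.
  rewrite muT => E; exists (fun=> 0%R), m, 1%R; split=> //.
  - by move=> D _; rewrite big1.
  - move=> x; rewrite invey /= powRr0 mulr1 -lee_fin -E.
    have := counting_ae (ess_sup_ge mu (abse \o (EFin \o f))) x.
    by rewrite /= ger0_norm.
  - by rewrite powR1 mulr1.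
rewrite lee_fin in p1; have p0 : (0 < p)%R by rewrite (lt_le_trans _ p1).
move=> E; exists (fun x => f x `^ p)%R, 1%R, (m `^ p)%R; split=> //.
- by move=> x; exact: powR_ge0.
- move=> D uD; rewrite -lee_fin.
  apply: le_trans (sum_seq_le_integral _ uD) _; first by move=> x; exact: powR_ge0.
  rewrite -poweR_EFin -E -poweRrM mulVf ?gt_eqF// poweRe1; last first.
    by apply: integral_ge0 => x _; exact: poweR_ge0.
  rewrite le_eqVlt; apply/orP; left; apply/eqP; apply: eq_integral => x _ /=.
  by rewrite ger0_norm.
- by move=> x; rewrite inver gt_eqF//= mul1r -powRrM mulfV ?gt_eqF// powRr1.
- by rewrite inver gt_eqF//= mul1r -powRrM mulfV ?gt_eqF// powRr1.
Qed.

End EllNorm.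

(** * The inequality for groups *)

(** Coefficients on a finite spanning family of the torsion can be reduced modulo its exponent. *)
Lemma torsion_finite (A : zmodType) : finitely_generated A ->
  exists l : seq A, forall x, torsion_part [set: A] x -> x \in l.
Proof.
move=> fgA; have sT : is_subgroup [set: A] by apply/is_subgroupP.
have [n [y [M [M0 TE MT]]]] := torsion_exponent fgA sT.
case: M M0 MT => // M _ MT.
exists [seq \sum_i y i *+ c i | c : {ffun 'I_n -> 'I_M.+1}].
move=> x; rewrite TE => -[c _ <-]; apply/fintype.imageP.
have cM i : (absz (c i %% M.+1%:Z)%Z < M.+1)%N.
  by rewrite -ltz_nat gez0_abs ?modz_ge0// ltz_pmod.
exists [ffun i => Ordinal (cM i)] => //; apply: eq_bigr => i _.
rewrite ffunE /= {1}(divz_eq (c i) M.+1%:Z) mulrzDr mulrC mulrzA.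
rewrite -[y i *~ M.+1%:Z]/(y i *+ M.+1) MT; last by rewrite TE; exact: mem_Zspan.
by rewrite mul0rz add0r pmulrn gez0_abs ?modz_ge0.
Qed.

Lemma rational_coords_ker (A : zmodType) r (b : 'I_r -> A)
    (pi : {additive A -> 'rV[rat]_r}) x :
  rational_coords b pi -> pi x = 0 -> torsion_part [set: A] x.
Proof.
move=> [_ /(_ x)[c [t [xE -> tt]]]] /rowP c0.
have {}c0 i : c i = 0.
  by apply/eqP; rewrite -(intr_eq0 rat); have := c0 i; rewrite !mxE => /eqP.
by rewrite xE big1 ?add0r// => i _; rewrite c0 mulr0z.
Qed.

Section GroupBrascampLieb.
Variables (R : realType) (N : nat) (G : zmodType) (Gs : 'I_N -> zmodType).
Variables (phi : forall j : 'I_N, {additive G -> Gs j}) (s : 'I_N -> R).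
Hypothesis fgG : finitely_generated G.
Hypothesis fgGs : forall j, finitely_generated (Gs j).
Hypothesis s01 : forall j, 0 <= s j <= 1.

(* Passing to G tensor Q costs only a constant, as G has finite torsion. *)
Lemma group_brascamp_lieb :
  (forall H : set G, is_subgroup H ->
     (rank H)%:R <= \sum_j s j * (rank (phi j @` H))%:R) ->
  exists2 K : R, 0 <= K & forall (f : forall j, Gs j -> R) (S : 'I_N -> R),
    (forall j z, 0 <= f j z) -> (forall j, sum_le (f j) (S j)) ->
    sum_le (fun y => \prod_j f j (phi j y) `^ s j) (K * \prod_j S j `^ s j).
Proof.
move=> rk; have [r [b [pi coord]]] := rational_coords_exist fgG.
have [m [bs [pis coords]]] : exists (m : 'I_N -> nat)
    (bs : forall j, 'I_(m j) -> Gs j)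
    (pis : forall j, {additive Gs j -> 'rV[rat]_(m j)}),
    forall j, rational_coords (bs j) (pis j).
  pose w j := cid (rational_coords_exist (fgGs j)).
  pose w' j := cid (projT2 (w j)).
  exists (fun j => projT1 (w j)), (fun j => projT1 (w' j)),
    (fun j => projT1 (cid (projT2 (w' j)))) => j.
  exact: projT2 (cid (projT2 (w' j))).
pose Phi j : 'M[rat]_(r, m j) := \matrix_i pis j (phi j (b i)).
have piPhi j x : pis j (phi j x) = pi x *m Phi j.
  pose psi : {additive G -> 'rV[rat]_(m j)} := (pis j \o phi j)%FUN.
  exact: (rational_coords_comp psi x coord).
(* The condition at [W] is the rank condition for the subgroup of elements whose coordinates lie in
   [W]. *)
have cond : bl_cond Phi s.
  move=> W; pose H := [set x | (pi x <= W)%MS].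
  have sH : is_subgroup H by exact: preimage_subgroup.
  have HW i : exists h n, [/\ H h, (0 < n)%N & pi h = row i W *+ n].
    have [h [n [n0 hn]]] := rational_coords_lift (row i W) coord.
    exists h, n; split=> //; rewrite /H /= hn -scaler_nat.
    by apply: scalemx_sub; exact: row_sub.
  rewrite -(rank_mxrank fgG coord sH _ HW)//.
  apply: le_trans (rk H sH) _; rewrite le_eqVlt; apply/orP; left; apply/eqP.
  apply: eq_bigr => j _; congr (_ * _%:R).
  apply: (rank_mxrank (fgGs j) (coords j)); first exact: image_subgroup.
    by move=> _ [x Hx <-]; rewrite piPhi submxMr.
  move=> i; have [h [n [Hh n0 hn]]] := HW i.
  exists (phi j h), n; split=> //.
  by rewrite piPhi hn row_mul -!scaler_nat scalemxAl.
have bl := brascamp_lieb s01 cond.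
have [tor torP] := torsion_finite fgG.
exists (size tor)%:R => // f S f0 fS E uE.
pose D j := undup [seq phi j y | y <- E].
pose h j (z : 'rV[rat]_(m j)) := \sum_(x <- D j | pis j x == z) f j x.
have h0 j z : 0 <= h j z by exact: sumr_ge0.
have hS j : sum_le (h j) (S j).
  exact: (sum_le_pushforward _ (f0 j) (undup_uniq _) (fS j)).
pose T (v : 'rV[rat]_r) := \prod_j h j (v *m Phi j) `^ s j.
have T0 v : 0 <= T v by apply: prodr_ge0 => j _; exact: powR_ge0.
apply: (@le_trans _ _ (\sum_(y <- E) T (pi y))).
  rewrite big_seq [leRHS]big_seq; apply: ler_sum => y yE; apply: ler_prod => j _.
  rewrite powR_ge0 ge0_ler_powR ?nnegrE//; first by case/andP: (s01 j).
  have yD : phi j y \in D j by rewrite mem_undup; apply/mapP; exists y.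
  by rewrite /h -piPhi (big_rem _ yD)/= eqxx lerDl; exact: sumr_ge0.
rewrite (partition_big_seq pi).
apply: (@le_trans _ _ (\sum_(v <- undup (map pi E)) (size tor)%:R * T v)).
  (* Two points with the same coordinates differ by torsion, so each fibre of [pi] in [E] has at
     most [size tor] points. *)
  apply: ler_sum => v _; rewrite (eq_bigr (fun=> T v)); last by move=> y /eqP ->.
  rewrite big_const_seq iter_addr_0 -[leLHS]mulr_natl ler_wpM2r// ler_nat.
  rewrite -size_filter; case FE: [seq y <- E | pi y == v] => [//|y0 l].
  have y0E : y0 \in [seq y <- E | pi y == v] by rewrite FE mem_head.
  rewrite -FE -(size_map (fun y => y - y0)); apply: uniq_leq_size.
    by rewrite map_inj_uniq ?filter_uniq//; exact: addIr.
  move=> _ /mapP[y yE ->]; apply: torP; apply: (rational_coords_ker coord).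
  move: yE y0E; rewrite !mem_filter raddfB => /andP[/eqP -> _] /andP[/eqP -> _].
  by rewrite subrr.
by rewrite -mulr_sumr ler_wpM2l//; apply: (bl h S) => //; exact: undup_uniq.
Qed.

End GroupBrascampLieb.

(** In a basis of the free part of [K], the points of the box have coordinates of size at most Q M,
    and their torsion parts range over a finite set. For M > 0, the number 2 Q M + 1 of values of a
    coordinate is at most (2 Q + 1) M. *)
Lemma box_image_size (B : zmodType) (K : set B) n (x : 'I_n -> B) :
  finitely_generated B -> is_subgroup K -> (forall i, K (x i)) ->
  exists C : nat, forall M, (0 < M)%N -> exists l : seq B,
    [/\ uniq l, (size l <= C * M ^ rank K)%N &
      forall c : 'I_n -> nat, (forall i, c i < M)%N -> \sum_i x i *+ c i \in l].
Proof.
move=> fgB sK Kx; have [e [_ KE]] := rankP fgB sK.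
have [tor torP] := torsion_finite fgB.
have /choice[w wP] i : exists w : ('I_(rank K) -> int) * B,
    x i = \sum_k e k *~ w.1 k + w.2 /\ torsion_part [set: B] w.2.
  have [u [c _ <-] [t [_ tt] <-]] :
      [set x + t | x in Zspan e & t in torsion_part K] (x i).
    by rewrite -KE.
  by exists (c, t).
pose Q := (\sum_k \sum_i absz ((w i).1 k))%N.
exists ((2 * Q).+1 ^ rank K * size tor)%N => M M0.
pose box := {ffun 'I_(rank K) -> 'I_(2 * (Q * M)).+1}.
(* The shift by Q M encodes signed coordinates as natural numbers. *)
pose pt (d : box) t := \sum_k e k *~ ((d k)%:Z - (Q * M)%N%:Z) + t.
exists (undup [seq pt d t | d <- enum {: box}, t <- tor]).
split; first exact: undup_uniq.
  apply: leq_trans (size_undup _) _; rewrite size_allpairs -cardE card_ffun !card_ord.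
  rewrite mulnAC leq_mul2r -expnMn; apply/orP; right.
  case: (rank K) => // k; rewrite leq_exp2r//.
  by rewrite (mulSn (2 * Q)) -mulnA -addn1 addnC leq_add2r.
move=> c cM; rewrite mem_undup.
pose a k := \sum_i (w i).1 k * (c i)%:Z.
have aQ k : `|a k| <= (Q * M)%N%:Z.
  rewrite /Q (bigD1 k)//= mulnDl PoszD.
  suff : `|a k| <= ((\sum_i absz ((w i).1 k)) * M)%N%:Z.
    by move/le_trans; apply; rewrite lerDl.
  rewrite /a; apply: le_trans (ler_norm_sum _ _ _) _.
  rewrite big_distrl /= -[leRHS]natz natr_sum; apply: ler_sum => i _.
  by rewrite natz normrM PoszM abszE ler_wpM2l// ger0_norm// lez_nat ltnW.
have dP k : (absz (a k + (Q * M)%N%:Z)%R < (2 * (Q * M)).+1)%N.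
  have := aQ k; rewrite ler_norml => /andP[a1 a2].
  rewrite ltnS -lez_nat gez0_abs; last by move: a1; lia.
  by move: a2; lia.
have tt : torsion_part [set: B] (\sum_i (w i).2 *+ c i).
  apply: subgroup_sum; first by apply: torsion_subgroup; apply/is_subgroupP.
  move=> i _; apply: subgroupMn; last by case: (wP i).
  by apply: torsion_subgroup; apply/is_subgroupP.
apply/allpairsP; exists ([ffun k => Ordinal (dP k)], \sum_i (w i).2 *+ c i).
split; [by rewrite mem_enum | exact: torP |].
rewrite /pt /= (eq_bigr (fun k => e k *~ a k)); last first.
  move=> k _; rewrite ffunE /= gez0_abs ?addrK//.
  by have := aQ k; rewrite ler_norml => /andP[a1 _]; move: a1; lia.
rewrite (eq_bigr (fun i => \sum_k e k *~ (w i).1 k *~ (c i)%:Z + (w i).2 *+ c i)); last first.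
  by move=> i _; rewrite {1}(wP i).1 mulrnDl -sumrMnl.
rewrite big_split /= exchange_big; congr (_ + _); apply: eq_bigr => k _.
by rewrite /a mulrz_sumr; apply: eq_bigr => i _; rewrite mulrzA.
Qed.

(** * Necessity, and the theorem *)

Lemma exponent_le_of_growth (R : realType) (r : nat) (sigma D : R) :
  (forall M, (0 < M)%N -> (M ^ r)%:R <= D * M%:R `^ sigma) -> r%:R <= sigma.
Proof.
move=> H; rewrite leNgt; apply/negP => sr.
have d0 : 0 < r%:R - sigma by rewrite subr_gt0.
have D0 : 0 < D.
  by have := H 1%N isT; rewrite exp1n powR1 mulr1; apply: lt_le_trans.
(* This solves x^(r - sigma) = D; any integer M > x contradicts the bound. *)
pose x := D `^ (r%:R - sigma)^-1.
pose M := Num.bound x.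
have xM : x < M%:R by apply: archi_boundP; exact: powR_ge0.
have M0 : 0 < M%:R :> R by apply: le_lt_trans xM; exact: powR_ge0.
have := H M; rewrite -(ltr0n R) => /(_ M0); rewrite natrX -powR_mulrn ?ler0n//.
rewrite -[in leLHS](subrK sigma r%:R).
rewrite powRD ?(gt_eqF M0) ?implybT// ler_pM2r ?powR_gt0//; apply/negP; rewrite -ltNge.
have -> : D = x `^ (r%:R - sigma).
  by rewrite /x -powRrM mulVf ?gt_eqF// powRr1// ltW.
by rewrite gt0_ltr_powR ?nnegrE ?powR_ge0.
Qed.

Lemma powR_prod_const (R : realType) (I : Type) (r : seq I) (x : R) (a : I -> R) :
  (forall i, 0 <= a i) ->
  \prod_(i <- r) x `^ a i = x `^ (\sum_(i <- r) a i).
Proof.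
move=> a0; suff : 0 <= \sum_(i <- r) a i /\
  \prod_(i <- r) x `^ a i = x `^ (\sum_(i <- r) a i) by case.
elim/big_ind2 : _ => [|x1 x2 y1 y2 [? ->] [? ->]|i _//].
  by rewrite powRr0.
by rewrite addr_ge0// powRD_ge0.
Qed.

Lemma Zfree_box_inj (A : zmodType) r (b : 'I_r -> A) M : Zfree b ->
  injective (fun c : {ffun 'I_r -> 'I_M} => \sum_i b i *+ c i).
Proof.
move=> bfree c d cd; apply/ffunP => i; apply: val_inj => /=.
suff : (c i)%:Z - (d i)%:Z = 0 by move/eqP; rewrite subr_eq0 eqz_nat => /eqP.
apply: (bfree (fun i => (c i)%:Z - (d i)%:Z)).
rewrite (eq_bigr (fun i => b i *+ c i - b i *+ d i)).
  by rewrite sumrB cd subrr.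
by move=> k _; rewrite mulrzBr.
Qed.

Section ERealProducts.
Variable R : realType.
Local Open Scope ereal_scope.

Lemma le_prode (I : Type) (r : seq I) (f g : I -> \bar R) :
  (forall i, 0 <= f i) -> (forall i, f i <= g i) ->
  \prod_(i <- r) f i <= \prod_(i <- r) g i.
Proof.
move=> f0 fg; elim: r => [|i r IH]; first by rewrite !big_nil.
by rewrite !big_cons lee_pmul ?prode_ge0.
Qed.

Lemma prode_gt0 (I : Type) (r : seq I) (P : pred I) (f : I -> \bar R) :
  (forall i, 0 < f i) -> 0 < \prod_(i <- r | P i) f i.
Proof. by move=> f0; elim/big_ind : _ => // x y; exact: mule_gt0. Qed.

Lemma prode_pinfty n (f : 'I_n -> \bar R) j :
  (forall i, 0 < f i) -> f j = +oo -> \prod_i f i = +oo.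
Proof. by move=> f0 fj; rewrite (bigD1 j)//= fj gt0_mulye// prode_gt0. Qed.

End ERealProducts.

Local Open Scope ereal_scope.

Theorem theorem2p4 (R : realType) (N : nat)
    (G : zmodType) (Gs : 'I_N -> zmodType)
    (phi : forall j : 'I_N, {additive G -> Gs j}) (p : 'I_N -> \bar R)
    (fgG : finitely_generated G)
    (fgGs : forall j : 'I_N, finitely_generated (Gs j))
    (phi_index : forall j : 'I_N, finite_index (range (phi j)))
    (p_ge1 : forall j : 'I_N, 1 <= p j) :
  (exists C : R, forall f : forall j : 'I_N, Gs j -> R,
      (forall (j : 'I_N) (x : Gs j), (0 <= f j x)%R) ->
      \esum_(y in [set: G]) (\prod_(j < N) f j (phi j y))%R%:E
        <= C%:E * \prod_(j < N) ell_norm (p j) (f j))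
  <->
  (forall H : set G, is_subgroup H ->
      (rank H)%:R%:E
        <= \sum_(j < N) (p j)^-1 * (rank (phi j @` H))%:R%:E).
Proof.
pose s j := fine (p j)^-1.
have sE j : (p j)^-1 = (s j)%:E.
  rewrite /s; case: (p j) (p_ge1 j) => [x x1|_|//]; last by rewrite invey.
  by rewrite inver gt_eqF//; rewrite lee_fin in x1; rewrite (lt_le_trans _ x1).
have s01 j : (0 <= s j <= 1)%R.
  rewrite /s; case: (p j) (p_ge1 j) => [x x1|_|//]; last by rewrite invey lexx ler01.
  rewrite lee_fin in x1; have x0 : (0 < x)%R by rewrite (lt_le_trans _ x1).
  by rewrite inver gt_eqF//= invr_ge0 (ltW x0) invf_le1.
have rankE (H : set G) : \sum_(j < N) (p j)^-1 * (rank (phi j @` H))%:R%:E =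
    (\sum_j s j * (rank (phi j @` H))%:R)%R%:E.
  by rewrite -sumEFin; apply: eq_bigr => j _; rewrite sE EFinM.
split=> [[C HC] H sH|rk].
  rewrite rankE lee_fin.
  have [b [bfree bH]] := rankP fgG sH.
  have Hb i : H (b i).
    rewrite bH; exists (b i); first exact: mem_Zspan.
    by exists 0%R; rewrite ?addr0//; apply: subgroup0; exact: torsion_subgroup.
  have /choice[c cP] j : exists c : nat, forall M, (0 < M)%N ->
      exists l : seq (Gs j), [/\ uniq l, (size l <= c * M ^ rank (phi j @` H))%N &
        forall k : 'I_(rank H) -> nat, (forall i, k i < M)%N ->
          (\sum_i phi j (b i) *+ k i)%R \in l].
    apply: box_image_size => //; first exact: image_subgroup.
    by move=> i; exists (b i).
  (* The sign of [C] is not known, hence the absolute value. *)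
  apply: (@exponent_le_of_growth _ _ _ (`|C| * \prod_j (c j)%:R `^ s j)%R) => M M0.
  pose l j := projT1 (cid (cP j M M0)).
  have lP j := projT2 (cid (cP j M M0)).
  pose f j (x : Gs j) : R := (x \in l j)%:R%R.
  pose box (k : {ffun 'I_(rank H) -> 'I_M}) := (\sum_i b i *+ k i)%R.
  have fbox k j : f j (phi j (box k)) = 1%R.
    rewrite /f raddf_sum; have [_ _] := lP j.
    move=> /(_ (fun i => k i) (fun i => ltn_ord (k i))).
    by under eq_bigr do rewrite -raddfMn; move=> ->.
  have uE : uniq [seq box k | k <- enum {: {ffun 'I_(rank H) -> 'I_M}}].
    by rewrite map_inj_uniq ?enum_uniq//; exact: Zfree_box_inj.
  have f0 j x : (0 <= f j x)%R by [].
  have := le_trans (sum_seq_le_esum _ uE) (HC f f0).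
  (* The box has M^rank(H) distinct points, and all the indicators are 1 on it. *)
  rewrite [X in X%:E <= _](_ : _ = (M ^ rank H)%:R)%R; last first.
    rewrite big_map big_enum /= (eq_bigr (fun=> 1%R)).
      by rewrite sumr_const card_ffun !card_ord.
    by move=> k _; rewrite big1.
  have bound : \prod_(j < N) ell_norm (p j) (f j) <=
      (\prod_j ((c j)%:R `^ s j * M%:R `^ (s j * (rank (phi j @` H))%:R)))%R%:E.
    rewrite -prodEFin; apply: le_prode => j; first exact: Lnorm_ge0.
    have [ul sl _] := lP j.
    apply: le_trans (ell_norm_indicator (p_ge1 j) ul) _; rewrite lee_fin -/(s j).
    rewrite [(s j * _)%R]mulrC powRrM powR_mulrn// -powRM// -natrX -natrM.
    have /andP[s0 _] := s01 j.
    by rewrite ge0_ler_powR ?nnegrE// ler_nat.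
  move=> h; rewrite -lee_fin; apply: le_trans h _.
  apply: (@le_trans _ _ (`|C|%R%:E * \prod_(j < N) ell_norm (p j) (f j))).
    rewrite lee_wpmul2r ?lee_fin ?ler_norm//.
    by apply: prode_ge0 => j _; exact: Lnorm_ge0.
  apply: le_trans (lee_wpmul2l _ bound) _; first by rewrite lee_fin.
  rewrite -EFinM lee_fin big_split /= mulrA powR_prod_const// => j.
  by rewrite mulr_ge0//; case/andP: (s01 j).
have [|K K0 HK] := @group_brascamp_lieb R N G Gs phi s fgG fgGs s01.
  by move=> H sH; rewrite -lee_fin -rankE; exact: rk.
(* [K] might be 0; a positive constant keeps the right-hand side infinite when a norm is
   infinite. *)
exists (K + 1)%R => f f0.
have K1 : (0 < K + 1)%R by rewrite ltr_wpDl.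
have norm0 j : 0 <= ell_norm (p j) (f j) by exact: Lnorm_ge0.
have bounds j (m : R) : ell_norm (p j) (f j) = m%:E ->
  exists w : (Gs j -> R) * R * R, [/\ forall x, (0 <= w.1.1 x)%R, (0 <= w.1.2)%R,
    sum_le w.1.1 w.2, forall x, (f j x <= w.1.2 * w.1.1 x `^ s j)%R &
    (w.1.2 * w.2 `^ s j)%R = m].
  by move=> /(ell_norm_sum_le (p_ge1 j) (f0 j))[F [c [S ?]]]; exists (F, c, S).
(* Zero norms come first, since the product may then contain 0 times infinity; the left-hand side
   vanishes in this case. *)
have [[j fj0]|nz] := pselect (exists j, ell_norm (p j) (f j) = 0).
  have fz y : f j y = 0%R.
    have [[[F c] S] /= [F0 c0 FS fF cS]] := bounds j _ fj0.
    apply/eqP; rewrite eq_le f0 andbT (le_trans (fF _))// -cS ler_wpM2l//.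
    rewrite ge0_ler_powR ?nnegrE//; first by case/andP: (s01 j).
      exact: sum_le_ge0 FS.
    exact: sum_le_at FS.
  rewrite esum1 ?mule_ge0 ?lee_fin ?(ltW K1)//; first exact: prode_ge0.
  by move=> y _; rewrite (bigD1 j)//= fz mul0r.
have pos j : 0 < ell_norm (p j) (f j).
  by rewrite lt0e norm0 andbT; apply: contra_notN nz => /eqP e; exists j.
have [[j fjoo]|fin] := pselect (exists j, ell_norm (p j) (f j) = +oo).
  by rewrite (prode_pinfty pos fjoo) gt0_muley ?lee_fin// leey.
pose m j := fine (ell_norm (p j) (f j)).
have mE j : ell_norm (p j) (f j) = (m j)%:E.
  rewrite /m fineK// ge0_fin_numE// ltey; apply/eqP => e; apply: fin.
  by exists j.
(* [w j] packs the function F, the factor c and the bound S that [ell_norm_sum_le] supplies for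
   [f j]. *)
pose w j := projT1 (cid (bounds j _ (mE j))).
have wP j := projT2 (cid (bounds j _ (mE j))).
rewrite (eq_bigr _ (fun j _ => mE j)) prodEFin -EFinM.
apply: esum_le_fin => E uE.
have w0 j x : (0 <= (w j).1.1 x)%R by case: (wP j).
have wS j : sum_le (w j).1.1 (w j).2 by case: (wP j).
apply: (@le_trans _ _ (\sum_(y <- E) (\prod_j (w j).1.2) *
    \prod_j (w j).1.1 (phi j y) `^ s j)%R).
  apply: ler_sum => y _; rewrite -big_split /=; apply: ler_prod => j _.
  by rewrite f0 /=; case: (wP j).
rewrite -mulr_sumr.
apply: (@le_trans _ _ ((\prod_j (w j).1.2) * (K * \prod_j (w j).2 `^ s j))%R).
  rewrite ler_wpM2l//; last exact: (HK (fun j => (w j).1.1) (fun j => (w j).2)).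
  by apply: prodr_ge0 => j _; case: (wP j).
rewrite mulrCA -big_split /= (eq_bigr m); last by move=> j _; case: (wP j).
rewrite ler_wpM2r// ?lerDl//; apply: prodr_ge0 => j _.
by rewrite -lee_fin -mE.
Qed.
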